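(* Let $f,h,u$ and the constants $L_{\nabla h},\sigma,L_{\nabla u}$ be as in the context, and suppose that $f+h$ is coercive, i.e. $\lim_{\|x\|\to+\infty}(f+h)(x)=+\infty$. Let $\nu,\mu>0$, $\underline\lambda>0$ and $\alpha\ge 0$ satisfy $$2\underline\lambda(L_{\nabla h}+\nu)+\underline\lambda^2L_{\nabla h}^2\left(\underline\lambda\frac{L_{\nabla h}^2}{\nu}+L_{\nabla u}+2\underline\lambda(L_{\nabla h}+\nu)\right)+2\alpha\left(\mu+\mu\underline\lambda^2L_{\nabla h}^2+\frac{(1+\underline\lambda L_{\nabla h})^2}{2\mu}\right)<\sigma,$$ and let $\overline\lambda>\underline\lambda$ be such that $M_1>M_2$, where $$M_1=\frac{\sigma}{2\overline\lambda}-L_{\nabla h}-\nu-\frac{\alpha}{\underline\lambda}\mu,$$ $$M_2=\overline\lambda^2 L_{\nabla h}^2\left(\frac{L_{\nabla h}^2}{2\nu}+\nu+L_{\nabla h}+\frac{L_{\nabla u}}{2\underline\lambda}\right)+\frac{\alpha}{\underline\lambda}\left(\mu\overline\lambda^2L_{\nabla h}^2+\frac{(1+\overline\lambda L_{\nabla h})^2}{2\mu}\right).$$ Let $(x_n)_{n\in\mathbb{N}}$ and $(p_n)_{n\ge1}$ be sequences generated by the algorithm in the context with these parameters $\underline\lambda,\overline\lambda,\alpha$. Assume that the function $$H:\mathbb{R}^m\times\mathbb{R}^m\to\overline{\mathbb{R}},\qquad H(x,y)=(f+h)(x)+M_2\|x-y\|^2,$$ is a KL function. Then: (i) $\sum_{n\geq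 1}\|x_n-p_n\|<+\infty$ and $\sum_{n\in\mathbb{N}}\|x_{n+1}-x_n\|<+\infty$; (ii) there exists $x\in\operatorname{crit}(f+h)$ such that $\lim_{n\to+\infty}x_n=\lim_{n\to+\infty}p_n=x$.
   Context: Setting. $m\ge1$ is an integer, $\mathbb{N}=\{0,1,2,\dots\}$, $\langle\cdot,\cdot\rangle$ and $\|\cdot\|$ are the Euclidean inner product and norm (product spaces are Euclidean too), and $\overline{\mathbb{R}}=[-\infty,+\infty]$. $f:\mathbb{R}^m\to(-\infty,+\infty]$ is proper (i.e. $\operatorname{dom} f=\{x:f(x)<+\infty\}\ne\emptyset$), lower semicontinuous and bounded from below. $h:\mathbb{R}^m\to\mathbb{R}$ is Fréchet differentiable with $L_{\nabla h}$-Lipschitz continuous gradient, $L_{\nabla h}\ge 0$. $u:\mathbb{R}^m\to\mathbb{R}$ is $\sigma$-strongly convex with $\sigma>0$ (i.e. $u-\frac{\sigma}{2}\|\cdot\|^2$ is convex) and differentiable with $L_{\nabla u}$-Lipschitz continuous gradient, $L_{\nabla u}>0$. Its Bregman distance is $D_u(x,y)=u(x)-u(y)-\langle\nabla u(y),x-y\rangle$. Algorithm. Given $\underline\lambda,\overline\lambda>0$ and $\alpha\ge0$, choose $x_0,x_1\in\mathbb{R}^m$ and sequences $(\lambda_n)_{n\ge1},(\alpha_n)_{n\ge1}$ with $0\le\alpha_n\le\alpha$ and $0<\underline\lambda\le\lambda_n\le\overline\lambda$ for all $n\ge1$. For all $n\ge1$: $$p_n\in\operatorname{argmin}_{x\in\mathbb{R}^m}\left[f(x)+\tfrac{1}{\lambda_n}D_u(x,x_n)+\langle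 x,\nabla h(x_n)\rangle+\tfrac{\alpha_n}{\lambda_n}\langle x,x_{n-1}-x_n\rangle\right],$$ $$x_{n+1}=p_n+\lambda_n[\nabla h(x_n)-\nabla h(p_n)].$$ (The argmin is nonempty; $p_n$ is any element of it.) Subdifferentials. For a proper lower semicontinuous $g:\mathbb{R}^d\to(-\infty,+\infty]$ and $x\in\operatorname{dom} g$, the Fréchet subdifferential is $\hat\partial g(x)=\{v: \liminf_{y\to x}\frac{g(y)-g(x)-\langle v,y-x\rangle}{\|y-x\|}\ge0\}$, and the limiting (Mordukhovich) subdifferential is $\partial g(x)=\{v:\exists x_n\to x,\ g(x_n)\to g(x),\ \exists v_n\in\hat\partial g(x_n),\ v_n\to v\}$; both are empty for $x\notin\operatorname{dom} g$. $\operatorname{crit}(g)=\{x:0\in\partial g(x)\}$ and $\operatorname{dom}\partial g=\{x:\partial g(x)\neq\emptyset\}$. KL functions. For $\eta\in(0,+\infty]$, $\Theta_\eta$ is the class of concave continuous $\varphi:[0,\eta)\to[0,+\infty)$ with $\varphi(0)=0$, $\varphi$ continuously differentiable on $(0,\eta)$, and $\varphi'(s)>0$ for $s\in(0,\eta)$. A proper lower semicontinuous $g:\mathbb{R}^d\to(-\infty,+\infty]$ satisfies the Kurdyka-Łojasiewicz (KL) property at $\overline x\in\operatorname{dom}\partial g$ if there exist $\eta\in(0,+\infty]$, a neighborhood $U$ of $\overline x$ and $\varphi\in\Theta_\eta$ such that $\varphi'(g(x)-g(\overline x))\operatorname{dist}(0,\partial g(x))\ge1$ for all $x\in U$ with $g(\overline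 x)<g(x)<g(\overline x)+\eta$, where $\operatorname{dist}(z,A)=\inf_{y\in A}\|z-y\|$ (equal to $+\infty$ if $A=\emptyset$). $g$ is a KL function if it satisfies the KL property at every point of $\operatorname{dom}\partial g$. *)

(* Defs.v *)
From HB Require Import structures.
From mathcomp Require Import all_boot all_order all_algebra.
From mathcomp Require Import all_classical all_reals all_analysis.

Set Implicit Arguments.
Unset Strict Implicit.
Unset Printing Implicit Defensive.

Import Order.TTheory GRing.Theory Num.Theory.
Import numFieldNormedType.Exports.

Local Open Scope classical_set_scope.
Local Open Scope ring_scope.

(** R^d is ['rV[R]_d]. The library norm
    [`|x|] on ['rV[R]_d] is the sup norm; every quantitative notion below uses
    the Euclidean norm [enorm], and the library is only used for the topology,
    convergence and Fréchet differentiability, which do not depend on the choice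
    between these two equivalent norms. *)

Definition dotv (R : realType) (d : nat) (x y : 'rV[R]_d) : R :=
  \sum_(i < d) x ord0 i * y ord0 i.

Definition enorm (R : realType) (d : nat) (x : 'rV[R]_d) : R :=
  Num.sqrt (dotv x x).

(** Meaningful only where [h] is differentiable. *)
Definition grad (R : realType) (d : nat) (h : 'rV[R]_d -> R) (x : 'rV[R]_d)
    : 'rV[R]_d :=
  \row_(i < d) 'd h x (delta_mx ord0 i).

Definition smooth (R : realType) (d : nat) (h : 'rV[R]_d -> R) (L : R) : Prop :=
  (forall x, differentiable h x) /\
  (forall x y, enorm (grad h x - grad h y) <= L * enorm (x - y)).

Definition strongly_convex (R : realType) (d : nat) (u : 'rV[R]_d -> R)
    (sigma : R) : Prop :=
  @convex_function R 'rV[R]_d setT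
    (fun x : 'rV[R]_d => u x - sigma / 2 * enorm x ^+ 2).

Definition bregman (R : realType) (d : nat) (u : 'rV[R]_d -> R)
    (x y : 'rV[R]_d) : R :=
  u x - u y - dotv (grad u y) (x - y).

Definition proper_fun (R : realType) (d : nat) (g : 'rV[R]_d -> \bar R) : Prop :=
  (forall x, (-oo < g x)%E) /\ (exists x, (g x < +oo)%E).

Definition bounded_below (R : realType) (d : nat) (g : 'rV[R]_d -> \bar R)
    : Prop :=
  exists c : R, forall x, (c%:E <= g x)%E.

Definition coercive (R : realType) (d : nat) (g : 'rV[R]_d -> \bar R) : Prop :=
  forall A : R, exists r : R, forall x, r <= enorm x -> (A%:E <= g x)%E.

Definition argmin (R : realType) (d : nat) (g : 'rV[R]_d -> \bar R)
    : set 'rV[R]_d :=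
  [set p | forall y, (g p <= g y)%E].

Definition frechet_subdiff (R : realType) (d : nat) (g : 'rV[R]_d -> \bar R)
    (x : 'rV[R]_d) : set 'rV[R]_d :=
  [set v | (g x < +oo)%E /\
    (0 <= limf_einf
       (fun y => (g y - g x - (dotv v (y - x))%:E) * ((enorm (y - x))^-1)%:E)
       x^')%E].

Definition limiting_subdiff (R : realType) (d : nat) (g : 'rV[R]_d -> \bar R)
    (x : 'rV[R]_d) : set 'rV[R]_d :=
  [set v | (g x < +oo)%E /\
    exists (xs vs : nat -> 'rV[R]_d),
      [/\ xs n @[n --> \oo] --> x,
          g (xs n) @[n --> \oo] --> g x,
          forall n, frechet_subdiff g (xs n) (vs n)
        & vs n @[n --> \oo] --> v]].

Definition crit (R : realType) (d : nat) (g : 'rV[R]_d -> \bar R)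
    : set 'rV[R]_d :=
  [set x | limiting_subdiff g x 0].

Definition dom_subdiff (R : realType) (d : nat) (g : 'rV[R]_d -> \bar R)
    : set 'rV[R]_d :=
  [set x | limiting_subdiff g x !=set0].

(** [ereal_inf set0 = +oo]. *)
Definition dist_to (R : realType) (d : nat) (z : 'rV[R]_d)
    (A : set 'rV[R]_d) : \bar R :=
  ereal_inf [set (enorm (z - y))%:E | y in A].

(** The class of desingularizing functions on [0, eta); the values of [phi]
    outside this interval are irrelevant. *)
Definition desingularizing (R : realType) (eta : \bar R) (phi : R -> R) : Prop :=
  let I0 := [set s : R | 0 <= s /\ (s%:E < eta)%E] in
  let I := [set s : R | 0 < s /\ (s%:E < eta)%E] in
  [/\ @convex_function R R^o I0 (fun s : R => - phi s),
      {within I0, continuous phi},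
      (forall s, I0 s -> 0 <= phi s) /\ phi 0 = 0,
      forall s, I s -> derivable phi s 1 /\ {for s, continuous (derive1 phi)}
    & forall s, I s -> 0 < derive1 phi s].

Definition KL_at (R : realType) (d : nat) (g : 'rV[R]_d -> \bar R)
    (xbar : 'rV[R]_d) : Prop :=
  exists (eta : \bar R) (U : set 'rV[R]_d) (phi : R -> R),
    [/\ (0 < eta)%E, nbhs xbar U, desingularizing eta phi
      & forall x, U x -> (g xbar < g x)%E -> (g x < g xbar + eta)%E ->
          (1 <= (derive1 phi (fine (g x - g xbar)%E))%:E
                * dist_to 0 (limiting_subdiff g x))%E].

Definition KL_function (R : realType) (d : nat) (g : 'rV[R]_d -> \bar R)
    : Prop :=
  forall xbar, dom_subdiff g xbar -> KL_at g xbar.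

Definition objective (R : realType) (d : nat) (f : 'rV[R]_d -> \bar R)
    (h : 'rV[R]_d -> R) : 'rV[R]_d -> \bar R :=
  fun x => (f x + (h x)%:E)%E.

(** R^m x R^m with its Euclidean structure is ['rV[R]_(m + m)], the pair (x, y)
    being [row_mx x y]. *)
Definition lyapunov (R : realType) (m : nat) (f : 'rV[R]_m -> \bar R)
    (h : 'rV[R]_m -> R) (M : R) : 'rV[R]_(m + m) -> \bar R :=
  fun z => (objective f h (lsubmx z)
            + (M * enorm (lsubmx z - rsubmx z) ^+ 2)%:E)%E.

(** The entries [p 0], [lam 0] and [al 0] are unconstrained and never used. *)
Definition tseng_iterates (R : realType) (m : nat) (f : 'rV[R]_m -> \bar R)
    (h u : 'rV[R]_m -> R) (lamlo lamhi alpha : R) (lam al : nat -> R)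
    (x p : nat -> 'rV[R]_m) : Prop :=
  forall n, (1 <= n)%N ->
    [/\ 0 <= al n <= alpha,
        lamlo <= lam n <= lamhi,
        argmin
          (fun y => f y + ((lam n)^-1 * bregman u y (x n)
                           + dotv y (grad h (x n))
                           + al n / lam n * dotv y (x n.-1 - x n))%:E)%E
          (p n)
      & x n.+1 = p n + lam n *: (grad h (x n) - grad h (p n))].

Definition M1 (R : realType) (sigma Lh nu mu lamlo lamhi alpha : R) : R :=
  sigma / (2 * lamhi) - Lh - nu - alpha / lamlo * mu.

Definition M2 (R : realType) (Lh Lu nu mu lamlo lamhi alpha : R) : R :=
  lamhi ^+ 2 * Lh ^+ 2 * (Lh ^+ 2 / (2 * nu) + nu + Lh + Lu / (2 * lamlo))
  + alpha / lamlo * (mu * lamhi ^+ 2 * Lh ^+ 2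
                     + (1 + lamhi * Lh) ^+ 2 / (2 * mu)).

(* Main.v *)
(** Write [a_n = |x_n - p_n|] and [H_n = H(p_n, x_n)]. Comparing the values at
    [p_(n+1)] and [p_n] of the objective minimized at step [n+1], with the
    descent lemma for [h] and [u], strong convexity of [u] and Young's
    inequality, gives [H_(n+1) + (M1 - M2) a_(n+1)^2 <= H_n]. Optimality of [p_n]
    also produces a proximal subgradient of [H] at [(p_n, x_n)] of norm
    [O(a_n + a_(n-1))]. By coercivity the iterates have a cluster point [x]; lower
    semicontinuity together with optimality gives [H_n --> H(x, x)] and
    criticality. With the KL inequality at [(x, x)] and concavity of [phi],
    [a_(n+1) <= (a_n + a_(n-1)) / 4 + K (phi(s_n) - phi(s_(n+1)))] as long as
    [(p_n, x_n)] is near [(x, x)], where [s_n = H_n - H(x, x)]; this recursion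
    traps the sequence near [(x, x)] and sums. *)

Require Import Defs.
From HB Require Import structures.
From mathcomp Require Import all_boot all_order all_algebra.
From mathcomp Require Import all_classical all_reals all_analysis.
From mathcomp Require Import ring lra.

Set Implicit Arguments.
Unset Strict Implicit.
Unset Printing Implicit Defensive.

Import Order.TTheory GRing.Theory Num.Theory.
Import numFieldNormedType.Exports.

Local Open Scope classical_set_scope.
Local Open Scope ring_scope.

(** * Euclidean norm *)

Lemma dotvC (R : realType) (d : nat) (x y : 'rV[R]_d) : dotv x y = dotv y x.
Proof. by apply: eq_bigr => i _; rewrite mulrC. Qed.

Lemma dotvDl (R : realType) (d : nat) (x y z : 'rV[R]_d) :
  dotv (x + y) z = dotv x z + dotv y z.
Proof. by rewrite /dotv -big_split; apply: eq_bigr => i _; rewrite mxE mulrDl. Qed.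

Lemma dotvZl (R : realType) (d : nat) (a : R) (x z : 'rV[R]_d) :
  dotv (a *: x) z = a * dotv x z.
Proof. by rewrite /dotv mulr_sumr; apply: eq_bigr => i _; rewrite mxE mulrA. Qed.

Lemma dotvDr (R : realType) (d : nat) (x y z : 'rV[R]_d) :
  dotv z (x + y) = dotv z x + dotv z y.
Proof. by rewrite dotvC dotvDl !(dotvC z). Qed.

Lemma dotvZr (R : realType) (d : nat) (a : R) (x z : 'rV[R]_d) :
  dotv z (a *: x) = a * dotv z x.
Proof. by rewrite dotvC dotvZl dotvC. Qed.

Lemma dotvNl (R : realType) (d : nat) (x z : 'rV[R]_d) :
  dotv (- x) z = - dotv x z.
Proof. by rewrite -scaleN1r dotvZl mulN1r. Qed.

Lemma dotvNr (R : realType) (d : nat) (x z : 'rV[R]_d) :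
  dotv z (- x) = - dotv z x.
Proof. by rewrite dotvC dotvNl dotvC. Qed.

Definition dotvE := (dotvDl, dotvDr, dotvZl, dotvZr, dotvNl, dotvNr).

Lemma dotv_row_mx (R : realType) (d1 d2 : nat) (a b : 'rV[R]_d1)
    (a' b' : 'rV[R]_d2) :
  dotv (row_mx a a') (row_mx b b') = dotv a b + dotv a' b'.
Proof.
rewrite /dotv big_split_ord; congr (_ + _); apply: eq_bigr => i _.
  by rewrite !row_mxEl.
by rewrite !row_mxEr.
Qed.

Lemma dotvv_ge0 (R : realType) (d : nat) (x : 'rV[R]_d) : 0 <= dotv x x.
Proof. by apply: sumr_ge0 => i _; rewrite -expr2 sqr_ge0. Qed.

Lemma enorm_ge0 (R : realType) (d : nat) (x : 'rV[R]_d) : 0 <= enorm x.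
Proof. exact: sqrtr_ge0. Qed.

Lemma sqr_enorm (R : realType) (d : nat) (x : 'rV[R]_d) :
  enorm x ^+ 2 = dotv x x.
Proof. by rewrite sqr_sqrtr // dotvv_ge0. Qed.

Lemma enormN (R : realType) (d : nat) (x : 'rV[R]_d) : enorm (- x) = enorm x.
Proof. by rewrite /enorm !dotvE opprK. Qed.

Lemma enormB (R : realType) (d : nat) (x y : 'rV[R]_d) :
  enorm (x - y) = enorm (y - x).
Proof. by rewrite -enormN opprB. Qed.

Lemma enormZ (R : realType) (d : nat) (a : R) (x : 'rV[R]_d) :
  enorm (a *: x) = `|a| * enorm x.
Proof.
by rewrite /enorm dotvZl dotvZr mulrA -expr2 sqrtrM ?sqr_ge0 // sqrtr_sqr.
Qed.

Lemma enorm0 (R : realType) (d : nat) : enorm (0 : 'rV[R]_d) = 0.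
Proof. by rewrite -(scale0r 0) enormZ normr0 mul0r. Qed.

Lemma normr_le_enorm (R : realType) (d : nat) (x : 'rV[R]_d) :
  `|x| <= enorm x.
Proof.
rewrite [leLHS]/Num.norm /= mx_normrE.
apply/bigmax_leP; split=> [|[i j] _ /=]; first exact: enorm_ge0.
rewrite -(@ler_pXn2r _ 2) ?nnegrE ?enorm_ge0 // sqr_enorm (ord1 i).
rewrite real_normK ?num_real // /dotv (bigD1 j) //= -expr2 lerDl.
by apply: sumr_ge0 => k _; rewrite -expr2 sqr_ge0.
Qed.

(** The constant [d.+1] is crude, but it is positive also for [d = 0], so [nbhs_enorm_lt] can divide
    by it. *)
Lemma enorm_le_normr (R : realType) (d : nat) (x : 'rV[R]_d) :
  enorm x <= d.+1%:R * `|x|.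
Proof.
rewrite -(@ler_pXn2r _ 2) ?nnegrE ?enorm_ge0 ?mulr_ge0 //.
rewrite sqr_enorm /dotv exprMn.
apply: (@le_trans _ _ (\sum_(i < d) `|x| ^+ 2)).
  apply: ler_sum => i _; rewrite -expr2 -(@real_normK _ (x _ _)) ?num_real //.
  rewrite ler_pXn2r ?nnegrE //.
  rewrite [leRHS]/Num.norm /= mx_normrE.
  exact: (le_bigmax_cond 0 (fun ij => `|x ij.1 ij.2|) (isT : xpredT (ord0, i))).
rewrite sumr_const card_ord -[leLHS]mulr_natl ler_wpM2r ?sqr_ge0 //.
by rewrite -natrX ler_nat (leq_trans (leqnSn _)) // leq_pmulr.
Qed.

Lemma enorm_eq0 (R : realType) (d : nat) (x : 'rV[R]_d) :
  (enorm x == 0) = (x == 0).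
Proof.
apply/eqP/eqP => [x0|->]; last exact: enorm0.
by apply/eqP; rewrite -normr_eq0 eq_le normr_ge0 andbT -x0 normr_le_enorm.
Qed.

Lemma cauchy_schwarz (R : realType) (d : nat) (x y : 'rV[R]_d) :
  dotv x y <= enorm x * enorm y.
Proof.
have [->|y0] := eqVneq y 0.
  by rewrite enorm0 mulr0 -(scale0r 0) dotvZr mul0r.
have ny : 0 < enorm y by rewrite lt_neqAle eq_sym enorm_eq0 y0 enorm_ge0.
have [->|x0] := eqVneq x 0.
  by rewrite enorm0 mul0r -(scale0r 0) dotvZl mul0r.
have nx : 0 < enorm x by rewrite lt_neqAle eq_sym enorm_eq0 x0 enorm_ge0.
(* This square equals [2 * enorm x * enorm y * (enorm x * enorm y - dotv x y)]. *)
have := dotvv_ge0 (enorm y *: x - enorm x *: y).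
rewrite !dotvE (dotvC y x) -!sqr_enorm => e.
have : 0 <= enorm x * enorm y * (enorm x * enorm y - dotv x y) by nra.
by rewrite pmulr_rge0 ?mulr_gt0 // subr_ge0.
Qed.

Lemma enormD (R : realType) (d : nat) (x y : 'rV[R]_d) :
  enorm (x + y) <= enorm x + enorm y.
Proof.
rewrite -(@ler_pXn2r _ 2) ?nnegrE ?addr_ge0 ?enorm_ge0 //.
have := cauchy_schwarz x y.
rewrite sqrrD !sqr_enorm !dotvE (dotvC y x) => e.
by rewrite mulr2n; lra.
Qed.

(** Expand the square norm of [c *: x - y] and divide by [2 * c]. *)
Lemma dotv_young (R : realType) (d : nat) (c : R) (x y : 'rV[R]_d) : 0 < c ->
  dotv x y <= c / 2 * enorm x ^+ 2 + (2 * c)^-1 * enorm y ^+ 2.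
Proof.
move=> c0; have := dotvv_ge0 (c *: x - y).
rewrite !dotvE (dotvC y x) -!sqr_enorm => e.
rewrite -subr_ge0 (_ : _ - _ = (2 * c)^-1 * (c ^+ 2 * enorm x ^+ 2
  + enorm y ^+ 2 - 2 * c * dotv x y)); last by field; rewrite gt_eqF.
by rewrite mulr_ge0 ?invr_ge0 ?mulr_ge0 ?(ltW c0) //; nra.
Qed.

Lemma sqr_enormD_le (R : realType) (d : nat) (x y : 'rV[R]_d) :
  enorm (x + y) ^+ 2 <= 2 * enorm x ^+ 2 + 2 * enorm y ^+ 2.
Proof.
have := dotvv_ge0 (x - y).
by rewrite !sqr_enorm !dotvE => e; lra.
Qed.

Lemma enorm_row_mx (R : realType) (d1 d2 : nat) (a : 'rV[R]_d1)
    (b : 'rV[R]_d2) : enorm (row_mx a b) <= enorm a + enorm b.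
Proof.
rewrite -(@ler_pXn2r _ 2) ?nnegrE ?addr_ge0 ?enorm_ge0 //.
rewrite sqrrD !sqr_enorm dotv_row_mx lerD2r lerDl mulrn_wge0 //.
by rewrite mulr_ge0 ?enorm_ge0.
Qed.

Lemma nbhs_enorm (R : realType) (d : nat) (x : 'rV[R]_d) (U : set 'rV[R]_d) :
  nbhs x U -> exists2 r : R, 0 < r & forall y, enorm (y - x) < r -> U y.
Proof.
move=> /nbhs_ballP[r /= r0 xU]; exists r => // y yx; apply: xU.
by rewrite -ball_normE /= distrC (le_lt_trans (normr_le_enorm _)).
Qed.

Lemma cvg_enorm (R : realType) (d : nat) (xs : nat -> 'rV[R]_d)
    (x : 'rV[R]_d) :
  enorm (xs n - x) @[n --> \oo] --> 0 <-> xs n @[n --> \oo] --> x.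
Proof.
split=> [e0|xsx].
  apply/cvgrPdist_lt => e ep; move/cvgrPdist_lt : e0 => /(_ _ ep).
  apply: filterS => n; rewrite sub0r normrN ger0_norm ?enorm_ge0 //.
  by rewrite distrC; apply: le_lt_trans; exact: normr_le_enorm.
have e1 : d.+1%:R * `|xs n - x| @[n --> \oo] --> (0 : R).
  rewrite -(mulr0 d.+1%:R); apply: cvgM; first exact: cvg_cst.
  by apply/norm_cvg0P; rewrite -(subrr x); apply: cvgB => //; exact: cvg_cst.
apply: (squeeze_cvgr _ (cvg_cst 0) e1).
by apply: nearW => n; rewrite enorm_ge0 enorm_le_normr.
Qed.

(** * Smoothness and convexity *)

Lemma dotv_grad (R : realType) (d : nat) (h : 'rV[R]_d -> R)
    (x v : 'rV[R]_d) : 'd h x v = dotv (grad h x) v.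
Proof.
rewrite {1}(row_sum_delta v) linear_sum; apply: eq_bigr => i _.
by rewrite linearZ /= mxE mulrC.
Qed.

Lemma is_derive_line (R : realType) (d : nat) (h : 'rV[R]_d -> R)
    (x v : 'rV[R]_d) (t : R) : differentiable h (x + t *: v) ->
  is_derive t 1 (fun s : R => h (x + s *: v)) (dotv (grad h (x + t *: v)) v).
Proof.
move=> dh; pose g (s : R) := x + s *: v.
have dg : is_diff t g (0 + ( *:%R^~ v)) by exact: is_diffD.
have dhg : is_diff t (h \o g) ('d h (g t) \o (0 + ( *:%R^~ v))).
  by apply: is_diff_comp; apply: differentiableP.
split; first by apply: diff_derivable; exact: ex_diff.
rewrite deriveE; last exact: ex_diff.
by rewrite diff_val /= -dotv_grad /GRing.add /= add0r scale1r.
Qed.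

(** For small [t > 0] the difference quotient is at most [A + t * B]; let [t] tend to 0 from the
    right. Both strong convexity of [u] and concavity of [phi] become first-order inequalities in
    this way. *)
Lemma derive_le_quadratic (R : realType) (g : R -> R) (t0 dg A B : R) :
  is_derive t0 1 g dg ->
  (forall t, 0 < t < 1 -> g (t0 + t) - g t0 <= t * A + t ^+ 2 * B) ->
  dg <= A.
Proof.
move=> [+ <-] gAB => /cvg_dnbhs_at_right gd.
have AB : A + t * B @[t --> (0 : R)^'+] --> A.
  apply: cvg_at_right_filter; rewrite -[X in _ --> X]addr0 -[X in _ + X](mul0r B).
  by apply: cvgD; [exact: cvg_cst | apply: cvgM => //; exact: cvg_cst].
apply: (ler_cvg_to gd AB); near=> t.
have t0' : 0 < t by near: t; exact: nbhs_right_gt.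
have t1 : t < 1 by near: t; exact: nbhs_right_lt.
rewrite /= [t%:A]mulr1 /GRing.scale /= (addrC t) -(ler_pM2l t0').
rewrite mulrA divff ?gt_eqF // mul1r (le_trans (gAB _ _)) ?t0' ?t1 //.
by rewrite le_eqVlt; apply/orP; left; apply/eqP; ring.
Unshelve. all: by end_near. Qed.

Lemma smooth_grad_line (R : realType) (d : nat) (h : 'rV[R]_d -> R) (L t : R)
    (x v : 'rV[R]_d) : smooth h L -> 0 <= t ->
  `|dotv (grad h (x + t *: v)) v - dotv (grad h x) v| <= L * t * enorm v ^+ 2.
Proof.
move=> [_ hL] t0; rewrite -dotvNl -dotvDl.
apply: (@le_trans _ _ (enorm (grad h (x + t *: v) - grad h x) * enorm v)).
  rewrite ler_norml cauchy_schwarz andbT lerNl -dotvNl.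
  by rewrite (le_trans (cauchy_schwarz _ _)) // enormN.
rewrite expr2 mulrA ler_wpM2r ?enorm_ge0 // (le_trans (hL _ _)) //.
by rewrite (addrC x) addrK enormZ ger0_norm // mulrA.
Qed.

Lemma is_derive_quadratic_shift (R : realType) (g : R -> R) (t dg e B C : R) :
  is_derive t 1 g dg ->
  is_derive t 1 (fun s : R => e * (g s - s * B) - s ^+ 2 * C)
    (e * (dg - B) - t * (C + C)).
Proof.
move=> gd; apply: is_derive_eq.
rewrite !scaler0 !add0r ![_%:A]mulr1.
transitivity (e * (dg - B) - C * (t + t)); first by [].
by ring.
Qed.

(** For [e = 1] and [e = -1], the function [e * (g t - t * dg 0) - t ^+ 2 * C] has nonpositive
    derivative on [t >= 0], so by the mean value theorem its value at 1 is at most its value at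
    0. *)
Lemma taylor_le (R : realType) (g dg : R -> R) (C : R) :
  (forall t : R, is_derive t 1 g (dg t)) ->
  (forall t : R, 0 <= t -> `|dg t - dg 0| <= t * (C + C)) ->
  `|g 1 - g 0 - dg 0| <= C.
Proof.
move=> gd gC.
have mono (e : R) : `|e| = 1 -> e * (g 1 - g 0 - dg 0) <= C.
  move=> e1.
  pose k (t : R) := e * (g t - t * dg 0) - t ^+ 2 * C.
  pose dk (t : R) := e * (dg t - dg 0) - t * (C + C).
  have kd (t : R) : is_derive t 1 k (dk t).
    exact: is_derive_quadratic_shift (gd t).
  have kc : {within `[0, 1], continuous k}.
    apply: continuous_subspaceT => t; apply: differentiable_continuous.
    by apply/derivable1_diffP; exact: ex_derive.
  have [c /itvP c01] := MVT_segment ler01 (fun t _ => kd t) kc.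
  have c0 : 0 <= c by rewrite c01.
  have : e * (dg c - dg 0) <= c * (C + C).
    by rewrite (le_trans (ler_norm _)) // normrM e1 mul1r gC.
  rewrite /k /dk => G E; lra.
rewrite ler_norml; have := mono 1; have := mono (-1).
rewrite normrN normr1 mulN1r mul1r => /(_ erefl) A /(_ erefl) B.
by rewrite B andbT lerNl A.
Qed.

(** This is [taylor_le] on the segment from [x] to [y]. The upper bound serves the decrease of the
    objective, the lower bound for [h] the construction of subgradients. *)
Lemma descent_lemma (R : realType) (d : nat) (h : 'rV[R]_d -> R) (L : R)
    (x y : 'rV[R]_d) : smooth h L ->
  `|h y - h x - dotv (grad h x) (y - x)| <= L / 2 * enorm (y - x) ^+ 2.
Proof.
move=> hL; set v := y - x.
have gd (t : R) : is_derive t 1 (fun s : R => h (x + s *: v))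
    (dotv (grad h (x + t *: v)) v) by exact: is_derive_line (hL.1 _).
have gC (t : R) : 0 <= t ->
    `|dotv (grad h (x + t *: v)) v - dotv (grad h (x + 0 *: v)) v|
      <= t * (L / 2 * enorm v ^+ 2 + L / 2 * enorm v ^+ 2).
  move=> t0; rewrite (scale0r v) (addr0 x).
  rewrite (le_trans (smooth_grad_line _ _ hL t0)) //.
  by rewrite -mulrDl -splitr (mulrC L) mulrA.
have := taylor_le gd gC; rewrite (scale0r v) (addr0 x) (scale1r v).
by rewrite [x + v](_ : _ = y) // /v addrC subrK.
Qed.

(** Unpacks the library notion, whose weight is a bundled element of the unit interval, for a weight
    given as a real with bounds. *)
Lemma convex_functionP (R : realType) (E : lmodType R) (D : set E)
    (f : E -> R) (x y : E) (t : R) :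
  @convex_function R E D f -> D x -> D y -> 0 <= t <= 1 ->
  f (t *: x + (1 - t) *: y) <= t * f x + (1 - t) * f y.
Proof.
move=> fc Dx Dy t01.
have t01' : Itv.spec (Itv.num_sem (R := R)) (Itv.Real `[0%Z, 1%Z]) t.
  by rewrite /= /Itv.num_sem /= in_itv /= num_real.
exact: (fc (Itv.mk t01') x y (mem_set Dx) (mem_set Dy)).
Qed.

(** With [v = x - y], strong convexity on the segment gives [u (y + t v) - u y <= t (u x - u y -
    sigma/2 |v|^2) + t^2 sigma/2 |v|^2], to which [derive_le_quadratic] applies. *)
Lemma strongly_convex_lower (R : realType) (d : nat) (u : 'rV[R]_d -> R)
    (sigma : R) (x y : 'rV[R]_d) :
  strongly_convex u sigma -> differentiable u y ->
  sigma / 2 * enorm (x - y) ^+ 2 <= bregman u x y.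
Proof.
move=> uc du; set v := x - y.
suff : dotv (grad u y) v <= u x - u y - sigma / 2 * enorm v ^+ 2.
  by rewrite /bregman -/v; lra.
have du0 : differentiable u (y + 0 *: v) by rewrite scale0r addr0.
have := is_derive_line du0; rewrite (scale0r v) (addr0 y) => D.
apply: (derive_le_quadratic (B := sigma / 2 * enorm v ^+ 2) D) => t t01.
rewrite add0r (scale0r v) (addr0 y).
have t01' : 0 <= t <= 1 by case/andP: t01 => *; rewrite !ltW.
have := convex_functionP uc I I t01' (x := x) (y := y).
have -> : t *: x + (1 - t) *: y = y + t *: v.
  by rewrite /v scalerBr scalerBl scale1r addrCA addrA.
rewrite !sqr_enorm /v !dotvE (dotvC y x).
move: (u (y + _)) (u x) (u y) (dotv x x) (dotv y y) (dotv x y).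
by move=> *; lra.
Qed.

(** The graph of the concave [phi] lies below its tangent at [s]. The point [t] may be the endpoint
    0, so the derivative is taken only at [s], along the segment towards [t]. *)
Lemma desingularizing_tangent (R : realType) (eta : \bar R) (phi : R -> R)
    (s t : R) : desingularizing eta phi ->
  0 <= t -> 0 < s -> (t%:E < eta)%E -> (s%:E < eta)%E ->
  derive1 phi s * (s - t) <= phi s - phi t.
Proof.
move=> [phic _ _ dphi _] t0 s0 te se.
have [sd _] := dphi s (conj s0 se).
pose l (r : R) := s + r *: (t - s).
have l0 : l 0 = s by rewrite /l scale0r addr0.
have dl : is_diff (0 : R) l (0 + ( *:%R^~ (t - s))) by exact: is_diffD.
have dp : differentiable phi (l 0) by rewrite l0; exact/derivable1_diffP.
have D : is_derive (0 : R) 1 (phi \o l) ((t - s) * derive1 phi s).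
  have dpl : is_diff (0 : R) (phi \o l)
      ('d phi (l 0) \o (0 + ( *:%R^~ (t - s)))).
    by apply: is_diff_comp; apply: differentiableP.
  split; first by apply: diff_derivable; exact: ex_diff.
  rewrite deriveE; last exact: ex_diff.
  rewrite diff_val /= deriv1E l0 //.
  by rewrite /GRing.add /= add0r scale1r.
have : - ((t - s) * derive1 phi s) <= phi s - phi t; last by lra.
apply: (derive_le_quadratic (B := 0) (is_deriveN D)) => r r01.
have r01' : 0 <= r <= 1 by case/andP: r01 => *; rewrite !ltW.
rewrite add0r.
change (- phi (l r) - - phi (l 0) <= r * (phi s - phi t) + r ^+ 2 * 0).
rewrite l0; have := convex_functionP phic (conj t0 te) (conj (ltW s0) se) r01'.
have -> : r *: (t : R^o) + (1 - r) *: (s : R^o) = l r.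
  by rewrite /l /GRing.scale /=; ring.
by move=> E; lra.
Qed.

(** * Subdifferentials *)

Lemma nbhs_enorm_lt (R : realType) (d : nat) (x : 'rV[R]_d) (e : R) :
  0 < e -> \forall y \near x, enorm (y - x) < e.
Proof.
move=> e0; have e0' : 0 < e / d.+1%:R by rewrite divr_gt0.
apply/nbhs_ballP; exists (e / d.+1%:R) => //= y; rewrite -ball_normE /= => yx.
rewrite (le_lt_trans (enorm_le_normr _)) // mulrC -ltr_pdivlMr //.
by rewrite distrC.
Qed.

(** Proximal subgradients are Fréchet subgradients: the quotient is at least [- K * enorm (y - x)],
    which tends to 0. Every subgradient in this development is obtained from such a quadratic
    minorant. *)
Lemma frechet_subdiff_quadratic (R : realType) (d : nat)
    (g : 'rV[R]_d -> \bar R) (x v : 'rV[R]_d) (gx K : R) :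
  g x = gx%:E ->
  (forall y, ((gx + dotv v (y - x) - K * enorm (y - x) ^+ 2)%:E <= g y)%E) ->
  frechet_subdiff g x v.
Proof.
move=> gxE gK; split; first by rewrite gxE ltry.
rewrite limf_einfE; apply/lee_addgt0Pr => e e0.
have K1 : 0 < `|K| + 1 by rewrite ltr_wpDl.
pose V := [set y | enorm (y - x) < e / (`|K| + 1) /\ y != x].
have xV : (x^') V.
  have := @nbhs_enorm_lt R d x _ (divr_gt0 e0 K1).
  by apply: filterS => y yx y0; split.
rewrite -leeBlDr // sub0e.
apply: le_trans (ereal_sup_ubound _); last by exists V.
apply: le_ereal_inf_tmp => _ [y [yx yNx] <-].
have q0 : 0 < enorm (y - x).
  by rewrite lt_neqAle eq_sym enorm_eq0 subr_eq0 yNx enorm_ge0.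
have := gK y; rewrite gxE; case: (g y) => [r| |] //=.
- rewrite !lee_fin => gr; rewrite ler_pdivlMr //.
  have qe : K * enorm (y - x) <= e.
    rewrite ltr_pdivlMr // in yx.
    by have := ler_norm K; nra.
  by nra.
- by move=> _; rewrite gt0_mulye ?leey // lte_fin invr_gt0.
Qed.

Lemma frechet_limiting_subdiff (R : realType) (d : nat)
    (g : 'rV[R]_d -> \bar R) (x v : 'rV[R]_d) :
  frechet_subdiff g x v -> limiting_subdiff g x v.
Proof.
move=> gv; split; first exact: gv.1.
exists (cst x), (cst v); split.
- exact: cvg_cst.
- exact: (@cvg_cst _ (g x)).
- by [].
- exact: cvg_cst.
Qed.

Lemma dist_to0_le (R : realType) (d : nat) (A : set 'rV[R]_d)
    (v : 'rV[R]_d) : A v -> (dist_to 0 A <= (enorm v)%:E)%E.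
Proof.
by move=> Av; apply: ereal_inf_lbound; exists v => //; rewrite sub0r enormN.
Qed.

(** * Finite length *)

(** Writing [b] for [K * (psi n.+1 - psi n.+2)], the weights 1/2 and 1/4 make
    [K * psi n.+1 + a n.+1 / 2 + a n / 4] drop by at least [a n.+2 / 2] when
    [a n.+2 <= (a n + a n.+1) / 4 + b]; the extra [D * a n.+1] in [W] then makes
    [W] drop by at least the length [D * (a n.+1 + a n.+2)] of the next step. *)
Lemma finite_length (R : realType) (a psi r : nat -> R) (K D rho : R)
    (N0 : nat) (W := fun n =>
      4 * D * (K * psi n.+1 + a n.+1 / 2 + a n / 4) + D * a n.+1) :
  (forall n, 0 <= a n) -> (forall n, (N0 <= n)%N -> 0 <= psi n.+1) ->
  0 <= K -> 0 < D -> 0 < rho ->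
  (forall n, r n.+2 <= r n.+1 + D * (a n.+1 + a n.+2)) ->
  (forall n, (N0 <= n)%N -> r n.+1 < rho ->
     a n.+2 <= (a n + a n.+1) / 4 + K * (psi n.+1 - psi n.+2)) ->
  (forall e N, 0 < e -> exists2 n, (N <= n)%N & r n.+1 + W n < e) ->
  (forall e, 0 < e -> exists N, forall n, (N <= n)%N -> r n.+1 < e) /\
  (exists N C, forall n, \sum_(i < n) a (N + i)%N <= C).
Proof.
move=> a0 psi0 K0 D0 rho0 rD aK small.
have W0 n : (N0 <= n)%N -> 0 <= W n.
  move=> /psi0 psin; have := a0 n; have := a0 n.+1 => a1 a2.
  have Kp := mulr_ge0 K0 psin.
  by rewrite addr_ge0 ?mulr_ge0 ?addr_ge0 ?divr_ge0 // ltW.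
have step n : (N0 <= n)%N -> r n.+1 + W n < rho ->
    r n.+2 + W n.+1 <= r n.+1 + W n /\
    W n.+1 + D * a n.+1 + D * a n.+2 <= W n.
  move=> n0 V; have rn : r n.+1 < rho by have := W0 n n0; lra.
  have aKn := aK _ n0 rn.
  have WW : W n.+1 + D * a n.+1 + D * a n.+2 <= W n.
    by rewrite /W; nra.
  by split=> //; have := rD n; lra.
(* The trap: the distance plus [W] never increases once it is below [rho], so the recursion remains
   applicable at all later indices. *)
have stay N : (N0 <= N)%N -> r N.+1 + W N < rho ->
    forall k, r (N + k).+1 + W (N + k)%N <= r N.+1 + W N.
  move=> N0N V; elim=> [|k IH]; first by rewrite addn0.
  have N0k : (N0 <= N + k)%N by rewrite (leq_trans N0N) ?leq_addr.
  have [+ _] := step _ N0k (le_lt_trans IH V).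
  by rewrite addnS => /le_trans; apply.
split=> [e e0|].
  have me0 : 0 < Num.min e rho by rewrite lt_min e0 rho0.
  have [N N0N] := small _ N0 me0; rewrite lt_min => /andP[Ve Vrho].
  exists N => n Nn; have := stay _ N0N Vrho (n - N)%N; rewrite subnKC // => V.
  by have := W0 n (leq_trans N0N Nn); lra.
have [N N0N Vrho] := small _ N0 rho0.
exists N.+1, (W N / D) => n; rewrite ler_pdivlMr //.
(* Telescoping of the drops of [W], keeping only the part [D * a n.+1] of each. *)
suff : W (N + n)%N + (\sum_(i < n) a (N.+1 + i)%N) * D <= W N.
  have N0n : (N0 <= N + n)%N by rewrite (leq_trans N0N) ?leq_addr.
  by have := W0 _ N0n; lra.
elim: n => [|n IH]; first by rewrite big_ord0 addn0; lra.
have N0n : (N0 <= N + n)%N by rewrite (leq_trans N0N) ?leq_addr.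
have [_] := step _ N0n (le_lt_trans (stay _ N0N Vrho n) Vrho).
have := mulr_ge0 (ltW D0) (a0 (N + n).+2).
by rewrite big_ord_recr /= addnS addSn mulrDl; lra.
Qed.

(** Every partial sum, from whatever starting index [k], is at most the sum of the first [N] terms
    plus [C]. *)
Lemma nneseries_lt_pinfty (R : realType) (b : nat -> R) (N k : nat) (C : R) :
  (forall n, 0 <= b n) -> (forall n, \sum_(i < n) b (N + i)%N <= C) ->
  (\sum_(k <= n <oo) (b n)%:E < +oo)%E.
Proof.
move=> b0 bC; apply: (@le_lt_trans _ _ (\sum_(i < N) b i + C)%:E); last first.
  by rewrite ltry.
apply: lime_le; first by apply: is_cvg_nneseries => n _ _; rewrite lee_fin.
apply: nearW => n; rewrite sumEFin lee_fin.
apply: (@le_trans _ _ (\sum_(i < N + n) b i)); last first.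
  by rewrite big_split_ord lerD2l; exact: bC.
rewrite -(big_mkord xpredT).
have [kn|nk] := leqP k n; last first.
  by rewrite [leLHS]big_geq ?(ltnW nk) //; apply: sumr_ge0 => i _.
rewrite [leRHS](big_cat_nat (n := k)) ?(leq_trans kn) ?leq_addl //=.
rewrite [X in _ + X](big_cat_nat (n := n)) ?leq_addl //=.
by rewrite ler_wpDl ?lerDl //; apply: sumr_ge0 => i _.
Qed.

(** * One step of the algorithm *)

(** Comparison with a point of the domain shows that [f p] is finite. Optimality then reads as a
    real-valued minorant of [f] touching it at [p], the form in which it is used below. *)
Lemma argmin_fin_num (R : realType) (d : nat) (f : 'rV[R]_d -> \bar R)
    (c : 'rV[R]_d -> R) (p : 'rV[R]_d) :
  proper_fun f -> argmin (fun y => f y + (c y)%:E)%E p ->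
  f p = (fine (f p))%:E /\
  forall y, ((fine (f p) + c p - c y)%:E <= f y)%E.
Proof.
move=> [fNy [y0 fy0]] pmin.
have fpy : (f p < +oo)%E.
  have := pmin y0; case E : (f p) => [r| |] //; first by rewrite ltry.
  by case: (f y0) fy0.
have fp : f p \is a fin_num by rewrite fin_numE gt_eqF ?fNy // lt_eqF.
have fpE := fineK fp; split => // y.
have := pmin y; rewrite -fpE; case: (f y) (fNy y) => [r| |] //.
  by rewrite !lee_fin => _; lra.
by move=> *; rewrite leey.
Qed.

Lemma bregman_le (R : realType) (d : nat) (u : 'rV[R]_d -> R) (L : R)
    (x y : 'rV[R]_d) : smooth u L ->
  bregman u x y <= L / 2 * enorm (x - y) ^+ 2.
Proof.
by move=> /(descent_lemma y x); rewrite ler_norml => /andP[_].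
Qed.

(** The real arithmetic of [tseng_descent]. There [A = |x1 - p1|^2], [B = |x0 - p0|],
    [D = |p1 - p0|^2], [E = |x1 - p0|] and [T = |x1 - x0|] in Euclidean norms; [Du1], [g1], [g2] are
    the Bregman, gradient and inertial terms at [p1], and [Du0], [g3], [g4] those at [p0]. *)
Lemma tseng_descent_arith (R : realType) (sigma Lh Lu nu mu lamlo lamhi alpha
    l a hp0 hp1 fp0 fp1 Du0 Du1 g1 g2 g3 g4 A B E T D : R) :
  0 <= Lh -> 0 < sigma -> 0 < Lu -> 0 < nu -> 0 < mu -> 0 < lamlo ->
  lamlo <= l <= lamhi -> 0 <= a <= alpha ->
  fp1 + (l^-1 * Du1 + g1 + a / l * g2) <= fp0 + (l^-1 * Du0 + g3 + a / l * g4) ->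
  sigma / 2 * A <= Du1 -> 0 <= A -> 0 <= B ->
  Du0 <= Lu / 2 * E ^+ 2 ->
  hp1 - hp0 + g3 - g1 <= Lh / 2 * D + (nu / 2 * D + (2 * nu)^-1 * (Lh * E) ^+ 2) ->
  g4 - g2 <= mu / 2 * D + (2 * mu)^-1 * T ^+ 2 ->
  0 <= D -> D <= 2 * A + 2 * E ^+ 2 ->
  0 <= E -> E <= lamhi * Lh * B ->
  0 <= T -> T <= (1 + lamhi * Lh) * B ->
  fp1 + hp1 + M1 sigma Lh nu mu lamlo lamhi alpha * A
    <= fp0 + hp0 + M2 Lh Lu nu mu lamlo lamhi alpha * B ^+ 2.
Proof.
move=> Lh0 s0 Lu0 nu0 mu0 ll0 /andP[lle leh] /andP[a0 aa] opt sD A0 B0 DuE hE gE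
  D0 DA E0 EB T0 TB.
have l0 : 0 < l by lra.
have lh0 : 0 < lamhi by lra.
set q := alpha / lamlo.
have aq : 0 <= a / l <= q.
  rewrite divr_ge0 ?(ltW l0) //= /q ler_pM ?invr_ge0 ?(ltW l0) //.
  by rewrite lef_pV2 ?posrE.
case/andP: aq => al0 alq.
have lV0 : 0 < l^-1 by rewrite invr_gt0.
have lVlo : l^-1 <= lamlo^-1 by rewrite lef_pV2 ?posrE.
have lVhi : lamhi^-1 <= l^-1 by rewrite lef_pV2 ?posrE.
have E2 : E ^+ 2 <= lamhi ^+ 2 * Lh ^+ 2 * B ^+ 2.
  by rewrite -!exprMn ler_pXn2r // nnegrE ?mulr_ge0 // ltW.
have T2 : T ^+ 2 <= (1 + lamhi * Lh) ^+ 2 * B ^+ 2.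
  by rewrite -!exprMn ler_pXn2r // nnegrE ?mulr_ge0 // addr_ge0 // mulr_ge0 // ltW.
have EE := sqr_ge0 E; have TT := sqr_ge0 T.
have k1 : l^-1 * Du0 <= lamlo^-1 * (Lu / 2 * E ^+ 2).
  apply: (@le_trans _ _ (l^-1 * (Lu / 2 * E ^+ 2))); first by rewrite ler_pM2l.
  by rewrite ler_wpM2r // mulr_ge0 // ltW // divr_gt0.
have k2 : lamhi^-1 * (sigma / 2 * A) <= l^-1 * Du1.
  by rewrite ler_pM ?invr_ge0 ?(ltW lh0) // mulr_ge0 // ltW // divr_gt0.
have k3 : a / l * (g4 - g2) <= q * (mu / 2 * D + (2 * mu)^-1 * T ^+ 2).
  apply: (@le_trans _ _ (a / l * (mu / 2 * D + (2 * mu)^-1 * T ^+ 2))).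
    by rewrite ler_wpM2l.
  rewrite ler_wpM2r // addr_ge0 // mulr_ge0 //.
    by rewrite ltW // divr_gt0.
  by rewrite invr_ge0 mulr_ge0 // ltW.
have q0 : 0 <= q by lra.
have nu0' := ltW nu0; have mu0' := ltW mu0.
have c1 : 0 <= lamlo^-1 * (Lu / 2).
  by rewrite mulr_ge0 ?invr_ge0 ?divr_ge0 // ltW.
have c2 : 0 <= (2 * nu)^-1 * Lh ^+ 2.
  by rewrite mulr_ge0 ?sqr_ge0 // invr_ge0 mulr_ge0.
(* From here the products needed for a linear conclusion: [k4] trades [D] for [A] and [E ^+ 2],
   which completes the coefficient [M1] of [A]; [k5] and [k6] trade [E ^+ 2] and [T ^+ 2] for
   [B ^+ 2] and produce [M2]. *)
have k4 : (Lh / 2 + nu / 2 + q * (mu / 2)) * D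
    <= (Lh / 2 + nu / 2 + q * (mu / 2)) * (2 * A + 2 * E ^+ 2).
  by rewrite ler_wpM2l // !addr_ge0 ?divr_ge0 // mulr_ge0 // divr_ge0.
have k5 : (lamlo^-1 * (Lu / 2) + nu + Lh + (2 * nu)^-1 * Lh ^+ 2 + q * mu) * E ^+ 2
   <= (lamlo^-1 * (Lu / 2) + nu + Lh + (2 * nu)^-1 * Lh ^+ 2 + q * mu)
      * (lamhi ^+ 2 * Lh ^+ 2 * B ^+ 2).
  by rewrite ler_wpM2l // !addr_ge0 ?c1 ?c2 // mulr_ge0.
have k6 : q * (2 * mu)^-1 * T ^+ 2
    <= q * (2 * mu)^-1 * ((1 + lamhi * Lh) ^+ 2 * B ^+ 2).
  by rewrite ler_wpM2l // mulr_ge0 // invr_ge0 mulr_ge0 // ltW.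
rewrite /M1 /M2 -/q !invfM; rewrite !invfM in k5 k6 k3 hE.
lra.
Qed.

(** With [r = h b - h a] and [g0] the gradient of [h] at [a], the first part is a linearization
    error, bounded by the descent lemma; the second is left to Young's inequality. *)
Lemma dotv_split (R : realType) (d : nat) (a b g0 g1 : 'rV[R]_d) (r : R) :
  r + dotv a g1 - dotv b g1 =
  (r - dotv g0 (b - a)) + dotv (b - a) (g0 - g1).
Proof. by rewrite (dotvC g0) !dotvE; ring. Qed.

Lemma dotv_subsub (R : realType) (d : nat) (a b x y : 'rV[R]_d) :
  dotv a (x - y) - dotv b (x - y) = dotv (b - a) (y - x).
Proof. by rewrite !dotvE; ring. Qed.

(** Index 0 is one step and index 1 the next; the hypothesis on [fp1] and [fp0] is the optimality of
    [p1] tested at [p0]. The last two bounds come from the correction step and the Lipschitz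
    gradient of [h]. *)
Lemma tseng_descent (R : realType) (m : nat) (h u : 'rV[R]_m -> R)
    (Lh sigma Lu nu mu lamlo lamhi alpha l0 l1 a1 fp0 fp1 : R)
    (x0 p0 x1 p1 : 'rV[R]_m) (c := fun y =>
      l1^-1 * bregman u y x1 + dotv y (grad h x1) + a1 / l1 * dotv y (x0 - x1)) :
  0 <= Lh -> smooth h Lh -> 0 < sigma -> strongly_convex u sigma ->
  0 < Lu -> smooth u Lu -> 0 < nu -> 0 < mu -> 0 < lamlo ->
  lamlo <= l0 <= lamhi -> lamlo <= l1 <= lamhi -> 0 <= a1 <= alpha ->
  x1 = p0 + l0 *: (grad h x0 - grad h p0) ->
  fp1 + c p1 <= fp0 + c p0 ->
  [/\ fp1 + h p1 + M1 sigma Lh nu mu lamlo lamhi alpha * enorm (x1 - p1) ^+ 2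
      <= fp0 + h p0 + M2 Lh Lu nu mu lamlo lamhi alpha * enorm (x0 - p0) ^+ 2,
    enorm (x1 - p0) <= lamhi * Lh * enorm (x0 - p0)
  & enorm (x1 - x0) <= (1 + lamhi * Lh) * enorm (x0 - p0)].
Proof.
move=> Lh0 hs s0 us Lu0 uS nu0 mu0 ll0 l0b l1b a1b x1E opt.
have e0 : enorm (x1 - p0) <= lamhi * Lh * enorm (x0 - p0).
  case/andP: l0b => l0l l0h; have l00 : 0 <= l0 by lra.
  rewrite x1E (addrC p0) addrK enormZ ger0_norm // -mulrA.
  by apply: ler_pM => //; [exact: enorm_ge0 | exact: hs.2].
have e1 : enorm (x1 - x0) <= (1 + lamhi * Lh) * enorm (x0 - p0).
  have -> : x1 - x0 = (x1 - p0) + (p0 - x0) by rewrite addrA subrK.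
  rewrite mulrDl mul1r [leRHS]addrC.
  by rewrite (le_trans (enormD _ _)) // lerD // enormB.
split=> //.
have d1 : p1 - p0 = (p1 - x1) + (x1 - p0) by rewrite addrA subrK.
apply: (tseng_descent_arith Lh0 s0 Lu0 nu0 mu0 ll0 l1b a1b opt
  (D := enorm (p1 - p0) ^+ 2) (E := enorm (x1 - p0)) (T := enorm (x1 - x0))
  (B := enorm (x0 - p0))) => //; rewrite ?sqr_ge0 ?enorm_ge0 //.
- by rewrite enormB; exact: strongly_convex_lower us (uS.1 _).
- by rewrite enormB; exact: bregman_le.
- have := descent_lemma p0 p1 hs; rewrite ler_norml => /andP[_ hle].
  have yle := dotv_young (p1 - p0) (grad h p0 - grad h x1) nu0.
  have gle : (2 * nu)^-1 * enorm (grad h p0 - grad h x1) ^+ 2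
      <= (2 * nu)^-1 * (Lh * enorm (x1 - p0)) ^+ 2.
    rewrite ler_wpM2l ?invr_ge0 ?mulr_ge0 ?(ltW nu0) //.
    rewrite ler_pXn2r ?nnegrE ?mulr_ge0 ?enorm_ge0 //.
    by rewrite (enormB x1) hs.2.
  rewrite (dotv_split p0 p1 (grad h p0)).
  by apply: lerD hle _; apply: le_trans yle _; rewrite lerD2l.
- have := dotv_young (p1 - p0) (x1 - x0) mu0; apply: le_trans.
  by rewrite dotv_subsub.
- by rewrite d1 (enormB x1 p1); exact: sqr_enormD_le.
Qed.

Lemma tseng_subgradient_split (R : realType) (d : nat) (l q : R)
    (y p x xp gp gx up ux : 'rV[R]_d) :
  dotv (gp - gx + l *: (ux - up) + q *: (x - xp)) (y - p) =
  dotv gp (y - p) + l * (dotv ux (y - x) - dotv ux (p - x) - dotv up (y - p))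
  - (dotv y gx - dotv p gx) - q * (dotv y (xp - x) - dotv p (xp - x)).
Proof.
rewrite !dotvE !(dotvC gx) !(dotvC y x) !(dotvC y xp) !(dotvC p x) !(dotvC p xp).
by ring.
Qed.

(** Takes the place of Fermat's rule and a sum rule: in the minorant of [f] given by optimality, [u]
    is replaced by its quadratic upper bound at [p], and [h] is added through its quadratic lower
    bound. *)
Lemma tseng_prox_subgradient (R : realType) (m : nat) (f : 'rV[R]_m -> \bar R)
    (h u : 'rV[R]_m -> R) (Lh Lu fp l q : R) (p x xp : 'rV[R]_m)
    (c := fun y => l^-1 * bregman u y x + dotv y (grad h x)
                   + q * dotv y (xp - x)) :
  smooth h Lh -> smooth u Lu -> 0 < l ->
  (forall y, (fp + c p - c y)%:E <= f y)%E ->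
  forall y,
  ((fp + h p
    + dotv (grad h p - grad h x + l^-1 *: (grad u x - grad u p)
            + q *: (x - xp)) (y - p)
    - (l^-1 * (Lu / 2) + Lh / 2) * enorm (y - p) ^+ 2)%:E
   <= objective f h y)%E.
Proof.
move=> hs us l0 opt y; rewrite /objective.
have := opt y; case: (f y) => [r| |] //=; last by move=> *; rewrite leey.
rewrite -EFinD !lee_fin => fpr.
have := descent_lemma p y hs; rewrite ler_norml => /andP[hle _].
have := descent_lemma p y us; rewrite ler_norml => /andP[_ ule].
have {}ule : l^-1 * (u y - u p - dotv (grad u p) (y - p))
    <= l^-1 * (Lu / 2 * enorm (y - p) ^+ 2) by rewrite ler_pM2l ?invr_gt0.
move: fpr hle ule; rewrite tseng_subgradient_split /c /bregman.
move: (grad h p) (grad h x) (grad u x) (grad u p) => gp gx ux up.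
move: (dotv gp (y - p)) (dotv up (y - p)) (enorm (y - p)) => A1 A2 A3.
move: (dotv ux (y - x)) (dotv ux (p - x)) (dotv y gx) (dotv p gx) => A4 A5 A6 A7.
move: (dotv y (xp - x)) (dotv p (xp - x)) (l^-1) => A8 A9 k.
move: (h y) (h p) (u y) (u x) (u p) => *; lra.
Qed.

Lemma tseng_subgradient_norm (R : realType) (m : nat) (h u : 'rV[R]_m -> R)
    (Lh Lu lamlo l q q' : R) (p x xp : 'rV[R]_m) :
  smooth h Lh -> smooth u Lu -> 0 < Lu -> 0 < lamlo -> lamlo <= l ->
  0 <= q <= q' ->
  enorm (grad h p - grad h x + l^-1 *: (grad u x - grad u p) + q *: (x - xp))
  <= (Lh + lamlo^-1 * Lu) * enorm (x - p) + q' * enorm (x - xp).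
Proof.
move=> hs us Lu0 ll0 ll /andP[q0 qq].
have l0 : 0 < l by lra.
have lV : 0 <= l^-1 <= lamlo^-1.
  by rewrite invr_ge0 (ltW l0) lef_pV2 ?posrE.
case/andP: lV => lV0 lVl.
rewrite (le_trans (enormD _ _)) // lerD //; last first.
  by rewrite enormZ ger0_norm // ler_wpM2r ?enorm_ge0.
rewrite mulrDl (le_trans (enormD _ _)) // lerD //.
  by rewrite (enormB x); exact: hs.2.
rewrite enormZ ger0_norm // -mulrA.
by apply: ler_pM => //; [exact: enorm_ge0 | exact: us.2].
Qed.

(** The convex function [|y - z|^2] lies above its linearization at [(p, x)]; the difference is
    [|(y - p) - (z - x)|^2]. *)
Lemma enorm_sub_expand (R : realType) (d : nat) (p x y z : 'rV[R]_d) :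
  enorm (p - x) ^+ 2 + 2 * dotv (p - x) (y - p) + 2 * dotv (x - p) (z - x)
  <= enorm (y - z) ^+ 2.
Proof.
have := dotvv_ge0 ((y - p) - (z - x)); rewrite !sqr_enorm !dotvE.
rewrite (dotvC p y) (dotvC x y) (dotvC z y) (dotvC z x) (dotvC z p) (dotvC p x).
by move=> E; lra.
Qed.

(** Add [M] times the linearization of [enorm_sub_expand] to the minorant of the objective; the
    quadratic error in [y] alone is at most the one in the pair. *)
Lemma lyapunov_subgradient (R : realType) (m : nat) (f : 'rV[R]_m -> \bar R)
    (h : 'rV[R]_m -> R) (M gp K : R) (p x w : 'rV[R]_m) :
  0 <= M -> 0 <= K -> objective f h p = gp%:E ->
  (forall y, (gp + dotv w (y - p) - K * enorm (y - p) ^+ 2)%:E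
     <= objective f h y)%E ->
  frechet_subdiff (lyapunov f h M) (row_mx p x)
    (row_mx (w + (2 * M) *: (p - x)) ((2 * M) *: (x - p))).
Proof.
move=> M0 K0 gpE prox.
apply: (@frechet_subdiff_quadratic _ _ _ _ _ (gp + M * enorm (p - x) ^+ 2) K).
  by rewrite /lyapunov row_mxKl row_mxKr gpE.
move=> z; rewrite -(hsubmxK z) /lyapunov row_mxKl row_mxKr.
move: (lsubmx z) (rsubmx z) => {z} y z.
have := prox y; case: (objective f h y) => [r| |] //=; last by move=> *; rewrite leey.
rewrite -EFinD !lee_fin => fr.
rewrite opp_row_mx add_row_mx dotv_row_mx (sqr_enorm (row_mx _ _)).
rewrite dotv_row_mx -!sqr_enorm.
have := ler_wpM2l M0 (enorm_sub_expand p x y z).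
have := mulr_ge0 K0 (sqr_ge0 (enorm (z - x))).
rewrite (dotvDl w) !(dotvZl (2 * M)).
move: fr; move: (dotv w (y - p)) (dotv (p - x) (y - p)) (dotv (x - p) (z - x)).
move: (enorm (p - x)) (enorm (y - z)) (enorm (y - p)) (enorm (z - x)) => *; lra.
Qed.

(** Optimality of [p] tested at a point [y] with value [r], after dropping the nonnegative Bregman
    term at [p]. The error vanishes as [p] and [x] tend to [y] and [x - xp] tends to 0, which bounds
    the limit of the values of [f] from above. *)
Lemma tseng_opt_gap (R : realType) (m : nat) (h u : 'rV[R]_m -> R)
    (sigma Lh Lu lamlo l q q' fp r : R) (p x xp y : 'rV[R]_m)
    (c := fun y => l^-1 * bregman u y x + dotv y (grad h x)
                   + q * dotv y (xp - x)) :
  smooth h Lh -> smooth u Lu -> 0 < sigma -> strongly_convex u sigma ->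
  0 < Lu -> 0 < lamlo -> lamlo <= l -> 0 <= q <= q' ->
  fp + c p - c y <= r ->
  fp <= r + (lamlo^-1 * (Lu / 2) * enorm (y - x) ^+ 2
    + enorm (y - p) * (enorm (grad h y) + Lh * enorm (y - x)
                       + q' * enorm (x - xp))).
Proof.
move=> hs us s0 usc Lu0 ll0 ll /andP[q0 qq] opt.
have l0 : 0 < l by lra.
have lV : 0 <= l^-1 <= lamlo^-1.
  by rewrite invr_ge0 (ltW l0) lef_pV2 ?posrE.
case/andP: lV => lV0 lVl.
have b1 : l^-1 * bregman u y x <= lamlo^-1 * (Lu / 2) * enorm (y - x) ^+ 2.
  apply: le_trans (ler_wpM2l lV0 (bregman_le y x us)) _.
  by rewrite mulrA ler_wpM2r ?sqr_ge0 // ler_wpM2r // divr_ge0 // ltW.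
have b2 : 0 <= l^-1 * bregman u p x.
  rewrite mulr_ge0 // (le_trans _ (strongly_convex_lower _ usc (us.1 _))) //.
  by rewrite mulr_ge0 ?sqr_ge0 // divr_ge0 // ltW.
have b3 : dotv (y - p) (grad h x)
    <= enorm (y - p) * (enorm (grad h y) + Lh * enorm (y - x)).
  apply: le_trans (cauchy_schwarz _ _) _.
  rewrite ler_wpM2l ?enorm_ge0 //.
  have -> : grad h x = grad h y + (grad h x - grad h y) by rewrite addrC subrK.
  rewrite (le_trans (enormD _ _)) // lerD2l (enormB y).
  exact: hs.2.
have b4 : q * dotv (y - p) (xp - x) <= enorm (y - p) * (q' * enorm (x - xp)).
  apply: le_trans (ler_wpM2l q0 (cauchy_schwarz _ _)) _.
  rewrite mulrCA ler_wpM2l ?enorm_ge0 // (enormB x).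
  by rewrite ler_wpM2r ?enorm_ge0.
have e : c y - c p = l^-1 * bregman u y x - l^-1 * bregman u p x
    + dotv (y - p) (grad h x) + q * dotv (y - p) (xp - x).
  by rewrite /c (dotvDl y) (dotvDl y) !(dotvNl p); ring.
clearbody c; rewrite mulrDr; lra.
Qed.

(** Bolzano-Weierstrass. The map [k] is not claimed to be increasing; [j < k j] makes it tend to
    infinity and lets the predecessor of [k j] be used. *)
Lemma enorm_bounded_cluster (R : realType) (d : nat) (v : nat -> 'rV[R]_d)
    (C : R) : (forall n, enorm (v n) <= C) ->
  exists (x : 'rV[R]_d) (k : nat -> nat),
    (forall j, (j < k j)%N) /\ enorm (v (k j) - x) @[j --> \oo] --> 0.
Proof.
move=> vC; pose A := [set y : 'rV[R]_d | `|y| <= C].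
have cA : compact A.
  apply: bounded_closed_compact.
    by exists C; split; [exact: num_real | move=> M CM y /le_trans; apply; exact: ltW].
  have -> : A = closed_ball_ (@Num.norm R 'rV[R]_d) 0 C.
    by apply/seteqP; split=> y; rewrite /A /closed_ball_ /= sub0r normrN.
  exact: closed_closed_ball_.
have [x [_ xcl]] : A `&` cluster (v n @[n --> \oo]) !=set0.
  apply: cA; exists 0%N => // n _ /=.
  by apply: le_trans (vC n); exact: normr_le_enorm.
have near_x (j : nat) : exists n, (j < n)%N /\ enorm (v n - x) < j.+1%:R^-1.
  have j0 : (0 : R) < j.+1%:R^-1 by rewrite invr_gt0.
  have vj : (v n @[n --> \oo]) (v @` [set n | (j < n)%N]).
    by exists j.+1 => // n /= jn; exists n.
  have [_ [[n /= jn <-] ?]] := xcl _ _ vj (nbhs_enorm_lt x j0).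
  by exists n.
have [k kP] := choice near_x; exists x, k; split=> [j|]; first exact: (kP j).1.
apply: (squeeze_cvgr _ (cvg_cst 0) (@cvg_harmonic R)).
by apply: nearW => j; rewrite enorm_ge0 ltW // (kP j).2.
Qed.

(** * Limits *)

Lemma cvg_index (k : nat -> nat) :
  (forall j, (j <= k j)%N) -> k j @[j --> \oo] --> \oo.
Proof.
move=> kj S [N _ NS]; exists N => // j /= Nj.
by apply: NS => /=; exact: leq_trans (kj j).
Qed.

(** The KL inequality and the tangent inequality give [c * a ^+ 2 <= s - s' <= (phi s - phi s') * (C
    * b)]. With [K = C / c * (phi s - phi s')] this is [a ^+ 2 <= b * K], and
    [b * K <= (b / 4 + K) ^+ 2]. *)
Lemma desingularizing_recursion (R : realType) (eta : \bar R) (phi : R -> R)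
    (c C s s' a b w : R) :
  desingularizing eta phi -> 0 < c -> 0 <= s' -> s' <= s -> (s%:E < eta)%E ->
  c * a ^+ 2 <= s - s' -> 0 <= a -> 0 <= b -> 0 <= C -> w <= C * b ->
  (0 < s -> 1 <= derive1 phi s * w) ->
  a <= b / 4 + C / c * (phi s - phi s').
Proof.
move=> phiD c0 s'0 s's se cas a0 b0 C0 wb phiw.
have s'e : (s'%:E < eta)%E by apply: le_lt_trans se; rewrite lee_fin.
have [s0|sN] := ltP 0 s; last first.
  have -> : s' = s by lra.
  have -> : a = 0.
    apply/eqP; rewrite -sqrf_eq0 eq_le sqr_ge0 andbT.
    by rewrite -(ler_pM2l c0) mulr0; lra.
  by rewrite subrr mulr0 addr0 divr_ge0.
have := phiw s0; have := desingularizing_tangent phiD s'0 s0 s'e se.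
have [_ _ _ _ /(_ s (conj s0 se))] := phiD.
move: (derive1 phi s) => q; set D := phi s - phi s' => q0 tan qw.
have ca : c * a ^+ 2 <= D * (C * b).
  have qCb : 1 <= q * (C * b) by apply: le_trans qw _; rewrite ler_pM2l.
  have ss : 0 <= s - s' by lra.
  apply: le_trans cas _; apply: (@le_trans _ _ ((s - s') * (q * (C * b)))).
    by rewrite ler_peMr.
  have -> : (s - s') * (q * (C * b)) = q * (s - s') * (C * b) by ring.
  by rewrite ler_wpM2r // mulr_ge0.
have D0 : 0 <= D by apply: le_trans tan; rewrite mulr_ge0 ?(ltW q0) ?subr_ge0.
set K := C / c * D.
have K0 : 0 <= K by rewrite mulr_ge0 // divr_ge0 // ltW.
have aK : a ^+ 2 <= b * K.
  rewrite -(ler_pM2l c0); apply: le_trans ca _.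
  rewrite le_eqVlt; apply/orP; left; apply/eqP.
  by rewrite /K; field; rewrite gt_eqF.
rewrite -(@ler_pXn2r _ 2) ?nnegrE ?addr_ge0 ?divr_ge0 //.
apply: le_trans aK _; have := sqr_ge0 (b / 4 - K); lra.
Qed.

Lemma descent_limit (R : realType) (E a : nat -> R) (c lb : R) :
  0 < c -> (forall n, 0 <= a n) -> (forall n, lb <= E n) ->
  (forall n, E n.+1 + c * a n.+1 ^+ 2 <= E n) ->
  exists l, [/\ E n @[n --> \oo] --> l, forall n, l <= E n,
    forall n, E n.+1 <= E n & a n @[n --> \oo] --> 0].
Proof.
move=> c0 a0 Elb Ea.
have Edec n : E n.+1 <= E n.
  by have := Ea n; have := mulr_ge0 (ltW c0) (sqr_ge0 (a n.+1)); lra.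
have Emon : {homo E : n m / (n <= m)%N >-> m <= n}.
  move=> n m /subnKC <-; elim: (m - n)%N => [|k IH]; first by rewrite addn0.
  by rewrite addnS (le_trans (Edec _)).
have Ecvg : cvgn E.
  by apply: nonincreasing_is_cvgn => //; exists lb => _ [n _ <-].
exists (limn E); split=> //; first by move=> n; exact: nonincreasing_cvgn_ge.
(* The decrease controls [a n.+1], hence the shift: [c * a n.+1 ^+ 2 <= E n - limn E]. *)
rewrite -cvg_shiftS; apply/cvgrPdist_lt => e e0.
have ce : 0 < c * e ^+ 2 by rewrite mulr_gt0 // exprn_gt0.
have El : \forall n \near \oo, E n < limn E + c * e ^+ 2.
  move/cvgrPdist_lt : (Ecvg) => /(_ _ ce); apply: filterS => n.
  by rewrite ltr_distlC => /andP[_].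
near=> n; rewrite /= sub0r normrN ger0_norm //.
rewrite -(@ltr_pXn2r _ 2) ?nnegrE ?(ltW e0) // -(ltr_pM2l c0).
have := nonincreasing_cvgn_ge Emon Ecvg n.+1.
have : E n < limn E + c * e ^+ 2 by near: n.
by have := Ea n; lra.
Unshelve. all: by end_near. Qed.

Lemma lsc_cvg_le (R : realType) (d : nat) (f : 'rV[R]_d -> \bar R)
    (xs : nat -> 'rV[R]_d) (r : nat -> R) (x : 'rV[R]_d) (l : R) :
  lower_semicontinuous f -> xs n @[n --> \oo] --> x ->
  (forall n, f (xs n) = (r n)%:E) -> r n @[n --> \oo] --> l ->
  (f x <= l%:E)%E.
Proof.
move=> flsc xsx fr rl; rewrite leNgt; apply/negP => lf.
have [b lb bf] : exists2 b, l < b & (b%:E < f x)%E.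
  move: lf; case: (f x) => [y| |] // ; last first.
    by move=> _; exists (l + 1); [rewrite ltrDl | rewrite ltry].
  rewrite lte_fin => ly; exists ((l + y) / 2); rewrite ?lte_fin; lra.
have [V xV Vf] := flsc x b bf.
have : b <= l.
  apply: (ler_cvg_to (cvg_cst b) rl); near=> n.
  have /Vf : V (xs n) by near: n; exact: xsx.
  by rewrite fr lte_fin => /ltW.
by lra.
Unshelve. all: by end_near. Qed.

Lemma desingularizing_cvg0 (R : realType) (eta : \bar R) (phi : R -> R)
    (s : nat -> R) : (0 < eta)%E -> desingularizing eta phi ->
  (forall n, 0 <= s n) -> s n @[n --> \oo] --> 0 ->
  (\forall n \near \oo, ((s n)%:E < eta)%E) /\
  phi (s n) @[n --> \oo] --> 0.
Proof.
move=> eta0 [_ /subspace_continuousP phic [_ phi0] _ _] s0 scvg.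
have se : \forall n \near \oo, ((s n)%:E < eta)%E.
  case: eta eta0 {phic} => [e| |] // e0; last first.
    by apply: nearW => n; rewrite ltry.
  move/cvgrPdist_lt : scvg => /(_ e e0); apply: filterS => n.
  by rewrite sub0r normrN ger0_norm // lte_fin.
split=> //.
rewrite -phi0; apply: cvg_trans (phic 0 (conj (lexx 0) eta0)).
move=> S /= [r r0 rS].
suff : \forall n \near \oo, S (phi (s n)) by [].
near=> n; apply: rS; last by split=> //; near: n.
by near: n; exact: (scvg _ (nbhsx_ballx (0 : R) r r0)).
Unshelve. all: by end_near. Qed.

(** * Convergence under the KL property *)

Lemma enorm_row_mx_ge (R : realType) (d1 d2 : nat) (a : 'rV[R]_d1)
    (b : 'rV[R]_d2) :
  enorm a <= enorm (row_mx a b) /\ enorm b <= enorm (row_mx a b).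
Proof.
by split; rewrite ler_sqrt ?dotvv_ge0 // dotv_row_mx ?lerDl ?lerDr dotvv_ge0.
Qed.

(** Along the chosen subsequence, this gives the smallness hypothesis of [finite_length]. *)
Lemma finite_length_potential_cvg0 (R : realType) (K D : R)
    (r psi a b : nat -> R) :
  r n @[n --> \oo] --> 0 -> psi n @[n --> \oo] --> 0 ->
  a n @[n --> \oo] --> 0 -> b n @[n --> \oo] --> 0 ->
  r n + (4 * D * (K * psi n + a n / 2 + b n / 4) + D * a n) @[n --> \oo] --> 0.
Proof.
move=> rc pc ac bc.
rewrite [X in _ --> X](_ : _ = 0 + (4 * D * (K * 0 + 0 / 2 + 0 / 4) + D * 0));
  last by ring.
have cM (c : R) (v : nat -> R) : v n @[n --> \oo] --> 0 ->
    c * v n @[n --> \oo] --> c * 0 by move=> vc; apply: cvgM => //; exact: cvg_cst.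
have cd (c : R) (v : nat -> R) : v n @[n --> \oo] --> 0 ->
    v n / c @[n --> \oo] --> 0 / c by move=> vc; apply: cvgM => //; exact: cvg_cst.
apply: cvgD => //; apply: cvgD; last exact: cM.
apply: cvgM; first exact: cvg_cst.
apply: cvgD; last exact: cd.
by apply: cvgD; [exact: cM | exact: cd].
Qed.

(** The KL inequality is only used at [(x, x)] for one cluster point [x] of
    [P]: [|z_n - (x, x)|] plus the potential of [finite_length] is nonincreasing
    near [(x, x)] and small along a subsequence, so no separate Cauchy argument
    is needed. *)
Lemma descent_KL_convergence (R : realType) (m : nat) (f : 'rV[R]_m -> \bar R)
    (h : 'rV[R]_m -> R) (N1 N2 K C1 C2 lb : R) (P X w : nat -> 'rV[R]_m)
    (gr : nat -> R) :
  0 <= N2 -> N2 < N1 -> 0 <= K -> 0 <= C1 -> 0 <= C2 ->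
  coercive (objective f h) -> (forall y, (lb%:E <= objective f h y)%E) ->
  (forall n, objective f h (P n) = (gr n)%:E) ->
  (forall n y, ((gr n + dotv (w n) (y - P n) - K * enorm (y - P n) ^+ 2)%:E
     <= objective f h y)%E) ->
  (forall n, gr n.+1 + N1 * enorm (X n.+1 - P n.+1) ^+ 2
     <= gr n + N2 * enorm (X n - P n) ^+ 2) ->
  (forall n, enorm (w n.+1)
     <= C1 * (enorm (X n - P n) + enorm (X n.+1 - P n.+1))) ->
  (forall n, enorm (X n.+1 - P n) <= C2 * enorm (X n - P n)) ->
  (forall n, enorm (X n.+1 - X n) <= C2 * enorm (X n - P n)) ->
  (forall (k : nat -> nat) (x : 'rV[R]_m) (l : R), (forall j, (j < k j)%N) ->
     enorm (X n - P n) @[n --> \oo] --> 0 ->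
     enorm (P (k j) - x) @[j --> \oo] --> 0 -> gr (k j) @[j --> \oo] --> l ->
     objective f h x = l%:E) ->
  KL_function (lyapunov f h N2) ->
  (exists N C, forall n,
     \sum_(i < n) enorm (X (N + i)%N - P (N + i)%N) <= C) /\
  exists x, [/\ crit (objective f h) x, X n @[n --> \oo] --> x
    & P n @[n --> \oo] --> x].
Proof.
move=> N20 N21 K0 C10 C20 coer lbg gE prox desc wn XP XX val KL.
pose a n := enorm (X n - P n).
have a0 n : 0 <= a n by exact: enorm_ge0.
(* The value of the Lyapunov function at [(P n, X n)]. *)
pose E n := gr n + N2 * a n ^+ 2.
have c0 : 0 < N1 - N2 by rewrite subr_gt0.
have Elb n : lb <= E n.
  rewrite /E ler_wpDr ?mulr_ge0 ?sqr_ge0 //.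
  by have := lbg (P n); rewrite gE lee_fin.
have Ea n : E n.+1 + (N1 - N2) * a n.+1 ^+ 2 <= E n.
  by have := desc n; rewrite -/(a n) -/(a n.+1) /E => ?; lra.
have [l [El lE Edec acvg]] := descent_limit c0 a0 Elb Ea.
(* The objective at [P n] is at most [E n <= E 0]; the added 1 makes a point outside the ball of
   radius [rad] contradictory. *)
have [rad radP] := coer (E 0%N + 1).
have Prad n : enorm (P n) <= rad.
  rewrite leNgt; apply/negP => /ltW /radP; rewrite gE lee_fin.
  have En : E n <= E 0%N by elim: n => // n; apply: le_trans.
  by have := mulr_ge0 N20 (sqr_ge0 (a n)); move: En; rewrite /E; lra.
have [x [k [kj Px]]] := enorm_bounded_cluster Prad.
have kk : k j @[j --> \oo] --> \oo by apply: cvg_index => j; exact: ltnW.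
have kS j : (k j).-1.+1 = k j by rewrite prednK // (leq_trans _ (kj j)).
have kk1 : (k j).-1 @[j --> \oo] --> \oo.
  by apply: cvg_index => j; rewrite -ltnS kS.
have ak : a (k j) @[j --> \oo] --> 0 by exact: cvg_comp kk acvg.
have ak1 : a (k j).-1 @[j --> \oo] --> 0 by exact: cvg_comp kk1 acvg.
have grk : gr (k j) @[j --> \oo] --> l.
  have -> : (fun j => gr (k j)) = (fun j => E (k j) - N2 * a (k j) * a (k j)).
    by apply/funext => j; rewrite /E expr2 mulrA addrK.
  rewrite [X in _ --> X](_ : _ = l - N2 * 0 * 0); last by ring.
  apply: cvgB; first exact: cvg_comp kk El.
  by apply: cvgM => //; apply: cvgM => //; exact: cvg_cst.
have gx : objective f h x = l%:E by exact: val kj acvg Px grk.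
have wk : enorm (w (k j)) @[j --> \oo] --> 0.
  have wk0 : C1 * (a (k j).-1 + a (k j)) @[j --> \oo] --> 0.
    rewrite [X in _ --> X](_ : _ = C1 * (0 + 0)); last by ring.
    by apply: cvgM; [exact: cvg_cst | exact: cvgD].
  apply: (squeeze_cvgr _ (cvg_cst 0) wk0); apply: nearW => j.
  by rewrite enorm_ge0 -(kS j) wn.
have critx : crit (objective f h) x.
  split; first by rewrite gx ltry.
  exists (P \o k), (w \o k); split.
  - exact/cvg_enorm.
  - rewrite gx [X in X @ _ --> _](_ : _ = (fun j => (gr (k j))%:E)).
      by apply: cvg_EFin => //; exact: nearW.
    by apply/funext => j; rewrite /= gE.
  - by move=> j; exact: frechet_subdiff_quadratic (gE _) (prox _).
  - by apply/cvg_enorm; under eq_cvg do rewrite subr0.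
pose z n := row_mx (P n) (X n); pose zs := row_mx x x.
pose W n := row_mx (w n + (2 * N2) *: (P n - X n)) ((2 * N2) *: (X n - P n)).
have Hz n : lyapunov f h N2 (z n) = (E n)%:E.
  by rewrite /lyapunov row_mxKl row_mxKr gE enormB.
have Hzs : lyapunov f h N2 zs = l%:E.
  by rewrite /lyapunov row_mxKl row_mxKr gx subrr enorm0 expr0n mulr0 adde0.
have Wf n : frechet_subdiff (lyapunov f h N2) (z n) (W n).
  exact: lyapunov_subgradient N20 K0 (gE n) (prox n).
have N22 : 0 <= 2 * N2 by rewrite mulr_ge0.
have WN n : enorm (W n) <= enorm (w n) + 4 * N2 * a n.
  rewrite (le_trans (enorm_row_mx _ _)) //.
  rewrite (@le_trans _ _ (enorm (w n) + 2 * N2 * a n + 2 * N2 * a n)) //.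
    rewrite lerD ?enormZ ?ger0_norm // (le_trans (enormD _ _)) // lerD2l.
    by rewrite enormZ ger0_norm // enormB.
  by lra.
have Wn n : enorm (W n.+1) <= (C1 + 4 * N2) * (a n + a n.+1).
  have := WN n.+1; have := wn n; rewrite -/(a n) -/(a n.+1).
  by have := mulr_ge0 N20 (a0 n); lra.
have rk : enorm (z (k j) - zs) @[j --> \oo] --> 0.
  have rk0 : enorm (P (k j) - x) + (a (k j) + enorm (P (k j) - x))
      @[j --> \oo] --> 0.
    rewrite [X in _ --> X](_ : _ = 0 + (0 + 0)); last by ring.
    by apply: cvgD => //; exact: cvgD.
  apply: (squeeze_cvgr _ (cvg_cst 0) rk0); apply: nearW => j.
  rewrite enorm_ge0 /z /zs opp_row_mx add_row_mx.
  rewrite (le_trans (enorm_row_mx _ _)) // lerD2l.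
  have -> : X (k j) - x = (X (k j) - P (k j)) + (P (k j) - x).
    by rewrite addrA subrK.
  exact: enormD.
have Wk : enorm (W (k j)) @[j --> \oo] --> 0.
  have Wk0 : enorm (w (k j)) + 4 * N2 * a (k j) @[j --> \oo] --> 0.
    rewrite [X in _ --> X](_ : _ = 0 + 4 * N2 * 0); last by ring.
    by apply: cvgD => //; apply: cvgM => //; exact: cvg_cst.
  apply: (squeeze_cvgr _ (cvg_cst 0) Wk0); apply: nearW => j.
  by rewrite enorm_ge0 WN.
(* The subgradients [W (k j)] tend to 0 and the values [E (k j)] to [l], so 0 is a limiting
   subgradient at [zs]. *)
have /KL [eta [U [phi [eta0 zsU phiD KLi]]]] :
    dom_subdiff (lyapunov f h N2) zs.
  exists 0; split; first by rewrite Hzs ltry.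
  exists (z \o k), (W \o k); split.
  - exact/cvg_enorm.
  - rewrite Hzs [X in X @ _ --> _](_ : _ = (fun j => (E (k j))%:E)).
      by apply: cvg_EFin; [exact: nearW | exact: cvg_comp kk El].
    by apply/funext => j; rewrite /= Hz.
  - by move=> j; exact: Wf.
  - by apply/cvg_enorm; under eq_cvg do rewrite subr0.
have [rho rho0 rhoU] := nbhs_enorm zsU.
pose s n := E n - l.
have s0 n : 0 <= s n by rewrite subr_ge0.
have scvg : s n @[n --> \oo] --> 0.
  by rewrite -(subrr l); apply: cvgB => //; exact: cvg_cst.
have [[N0 _ se] psicvg] := desingularizing_cvg0 eta0 phiD s0 scvg.
(* The move of [P] costs at most [a n.+2 + C2 * a n.+1] and that of [X] at most [C2 * a n.+1]. *)
pose D := 1 + 2 * C2.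
have D0 : 0 < D by rewrite ltr_pwDl // mulr_ge0.
pose KK := (C1 + 4 * N2) / (N1 - N2).
have CC0 : 0 <= C1 + 4 * N2 by rewrite addr_ge0 // mulr_ge0.
have KK0 : 0 <= KK by rewrite divr_ge0 // ltW.
pose psi n := phi (s n).
have psi0 n : (N0 <= n)%N -> 0 <= psi n.+1.
  move=> n0; have [_ _ [phi0 _] _ _] := phiD; apply: phi0; split=> //.
  by apply: se; rewrite /= leqW.
have rD n : enorm (z n.+2 - zs) <= enorm (z n.+1 - zs) + D * (a n.+1 + a n.+2).
  have -> : z n.+2 - zs = (z n.+1 - zs) + (z n.+2 - z n.+1).
    by rewrite [RHS]addrC addrA subrK.
  rewrite (le_trans (enormD _ _)) // lerD2l /z opp_row_mx add_row_mx (le_trans (enorm_row_mx _ _)) //.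
  have PP : enorm (P n.+2 - P n.+1) <= a n.+2 + C2 * a n.+1.
    have -> : P n.+2 - P n.+1 = (P n.+2 - X n.+2) + (X n.+2 - P n.+1).
      by rewrite addrA subrK.
    by rewrite (le_trans (enormD _ _)) // lerD // enormB.
  have XXn : enorm (X n.+2 - X n.+1) <= C2 * a n.+1 by exact: XX.
  rewrite (le_trans (lerD PP XXn)) // /D.
  by have := mulr_ge0 C20 (a0 n.+2); have := a0 n.+1; lra.
have rec n : (N0 <= n)%N -> enorm (z n.+1 - zs) < rho ->
    a n.+2 <= (a n + a n.+1) / 4 + KK * (psi n.+1 - psi n.+2).
  move=> n0 zr; have sen : ((s n.+1)%:E < eta)%E by apply: se; rewrite /= leqW.
  apply: (desingularizing_recursion (w := enorm (W n.+1)) phiD) => //.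
  - by rewrite lerD2r.
  - by have := Ea n.+1; rewrite /s; lra.
  - by rewrite addr_ge0.
  (* The KL inequality at [z n.+1], where the distance of 0 to the limiting subdifferential is at
     most the norm of [W n.+1]. *)
  move=> sn0; have := KLi (z n.+1) (rhoU _ zr); rewrite Hz Hzs !lte_fin.
  rewrite -subr_gt0 -/(s n.+1) => /(_ sn0).
  have lt_eta : ((E n.+1)%:E < l%:E + eta)%E.
    move: sen; case: (eta) => [e| |] //=; last by rewrite !ltry.
    by rewrite -EFinD !lte_fin /s; lra.
  move=> /(_ lt_eta); rewrite /= -/(s n.+1) => KLn.
  rewrite -lee_fin; apply: le_trans KLn _; rewrite EFinM.
  apply: lee_wpmul2l; last exact/dist_to0_le/frechet_limiting_subdiff.
  have [_ _ _ _ phi'0] := phiD.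
  by rewrite lee_fin ltW // phi'0.
have small e N : 0 < e -> exists2 n, (N <= n)%N &
    enorm (z n.+1 - zs)
    + (4 * D * (KK * psi n.+1 + a n.+1 / 2 + a n / 4) + D * a n.+1) < e.
  move=> e0.
  have /cvgrPdist_lt /(_ e e0) [j0 _ je] := finite_length_potential_cvg0 KK D
    rk (cvg_comp _ _ kk psicvg) ak ak1.
  (* The potential is evaluated at [n.+1], so the predecessor of a subsequence index is chosen. *)
  exists (k (maxn j0 N)).-1.
    by rewrite -ltnS kS (leq_ltn_trans (leq_maxr j0 N)).
  rewrite kS; have := je (maxn j0 N) (leq_maxl _ _).
  by rewrite sub0r normrN => /ltr_normlW.
have [r0 asum] := finite_length (r := fun n => enorm (z n - zs)) a0 psi0 KK0 D0 rho0 rD rec small.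
have cvgz (v : nat -> 'rV[R]_m) :
    (forall n, enorm (v n - x) <= enorm (z n - zs)) -> v n @[n --> \oo] --> x.
  move=> vz; rewrite -cvg_shiftS; apply/cvg_enorm/cvgrPdist_lt => e e0.
  have [N rN] := r0 e e0; exists N => // n /= Nn.
  rewrite sub0r normrN ger0_norm ?enorm_ge0 //.
  exact: le_lt_trans (vz _) (rN n Nn).
split=> //; exists x; split=> //; apply: cvgz => n;
  rewrite /z /zs opp_row_mx add_row_mx;
  by case: (enorm_row_mx_ge (P n - x) (X n - x)).
Qed.

(** * The algorithm *)

(** Coercivity gives a bound outside a ball; inside it, [f] is bounded below and the descent lemma
    at 0 bounds [h]. *)
Lemma objective_bounded_below (R : realType) (m : nat) (f : 'rV[R]_m -> \bar R)
    (h : 'rV[R]_m -> R) (Lh : R) :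
  bounded_below f -> smooth h Lh -> 0 <= Lh -> coercive (objective f h) ->
  exists lb : R, forall y, (lb%:E <= objective f h y)%E.
Proof.
move=> [c fc] hs Lh0 coer; have [rad radP] := coer 0.
pose b := c + (h 0 - enorm (grad h 0) * rad - Lh / 2 * rad ^+ 2).
exists (Num.min 0 b) => y.
have [ry|yr] := leP rad (enorm y).
  by apply: le_trans (radP _ ry); rewrite lee_fin ge_min lexx.
apply: (@le_trans _ _ b%:E); first by rewrite lee_fin ge_min lexx orbT.
rewrite /objective /b EFinD leeD // lee_fin.
have := descent_lemma 0 y hs; rewrite ler_norml subr0 => /andP[+ _].
have := cauchy_schwarz (- grad h 0) y; rewrite dotvNl enormN.
have y0 := enorm_ge0 y.
have : enorm (grad h 0) * enorm y <= enorm (grad h 0) * rad.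
  by rewrite ler_wpM2l ?enorm_ge0 // ltW.
have : Lh / 2 * enorm y ^+ 2 <= Lh / 2 * rad ^+ 2.
  rewrite ler_wpM2l ?divr_ge0 // ler_pXn2r ?nnegrE // ltW //.
  exact: le_lt_trans yr.
by move=> *; lra.
Qed.

Lemma M2_ge0 (R : realType) (Lh Lu nu mu lamlo lamhi alpha : R) :
  0 <= Lh -> 0 < Lu -> 0 < nu -> 0 < mu -> 0 < lamlo -> 0 <= alpha ->
  lamlo < lamhi -> 0 <= M2 Lh Lu nu mu lamlo lamhi alpha.
Proof.
move=> Lh0 /ltW Lu0 /ltW nu0 /ltW mu0 /ltW l0 a0 ll.
have q0 : 0 <= alpha / lamlo by rewrite divr_ge0.
have A : 0 <= Lh ^+ 2 / (2 * nu) + nu + Lh + Lu / (2 * lamlo).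
  by rewrite !addr_ge0 // divr_ge0 ?sqr_ge0 // mulr_ge0.
have B : 0 <= mu * lamhi ^+ 2 * Lh ^+ 2 + (1 + lamhi * Lh) ^+ 2 / (2 * mu).
  apply: addr_ge0; last by rewrite divr_ge0 ?sqr_ge0 // mulr_ge0.
  by apply: mulr_ge0 (sqr_ge0 _); apply: mulr_ge0 (sqr_ge0 _).
apply: addr_ge0; last exact: mulr_ge0.
by apply: mulr_ge0 A; apply: mulr_ge0; exact: sqr_ge0.
Qed.

Theorem theorem11 (R : realType) (m : nat) (hm : (1 <= m)%N)
    (f : 'rV[R]_m -> \bar R) (h u : 'rV[R]_m -> R)
    (Lh sigma Lu nu mu lamlo lamhi alpha : R)
    (f_proper : proper_fun f)
    (f_lsc : lower_semicontinuous f)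
    (f_bounded : bounded_below f)
    (Lh_ge0 : 0 <= Lh) (h_smooth : smooth h Lh)
    (sigma_gt0 : 0 < sigma) (u_sconvex : strongly_convex u sigma)
    (Lu_gt0 : 0 < Lu) (u_smooth : smooth u Lu)
    (fh_coercive : coercive (objective f h))
    (nu_gt0 : 0 < nu) (mu_gt0 : 0 < mu)
    (lamlo_gt0 : 0 < lamlo) (alpha_ge0 : 0 <= alpha)
    (params : 2 * lamlo * (Lh + nu)
       + lamlo ^+ 2 * Lh ^+ 2
         * (lamlo * (Lh ^+ 2 / nu) + Lu + 2 * lamlo * (Lh + nu))
       + 2 * alpha * (mu + mu * lamlo ^+ 2 * Lh ^+ 2
                      + (1 + lamlo * Lh) ^+ 2 / (2 * mu))
       < sigma)
    (lamhi_gt : lamlo < lamhi)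
    (M_lt : M2 Lh Lu nu mu lamlo lamhi alpha
            < M1 sigma Lh nu mu lamlo lamhi alpha)
    (lam al : nat -> R) (x p : nat -> 'rV[R]_m)
    (iterates : tseng_iterates f h u lamlo lamhi alpha lam al x p)
    (H_KL : KL_function (lyapunov f h (M2 Lh Lu nu mu lamlo lamhi alpha))) :
  ((\sum_(1 <= n <oo) (enorm (x n - p n))%:E < +oo)%E /\
   (\sum_(0 <= n <oo) (enorm (x n.+1 - x n))%:E < +oo)%E) /\
  (exists xstar : 'rV[R]_m,
    [/\ crit (objective f h) xstar,
        x n @[n --> \oo] --> xstar
      & p n @[n --> \oo] --> xstar]).
Proof.
(* Shifted by one because the algorithm constrains [p] only from index 1; the point preceding [X n]
   is then [x n]. *)
pose P n := p n.+1; pose X n := x n.+1.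
pose q n := al n.+1 / lam n.+1; pose l n := lam n.+1.
pose c n y := (l n)^-1 * bregman u y (X n) + dotv y (grad h (X n))
              + q n * dotv y (x n - X n).
pose fr n := fine (f (P n)).
pose q' := alpha / lamlo; pose C2 := 1 + lamhi * Lh.
have lb n : lamlo <= l n <= lamhi by have [] := iterates n.+1 isT.
have ab n : 0 <= al n.+1 <= alpha by have [] := iterates n.+1 isT.
have l0 n : 0 < l n by case/andP: (lb n) => + _; exact: lt_le_trans.
have qb n : 0 <= q n <= q'.
  case/andP: (ab n) => a0 aa; case/andP: (lb n) => ll _.
  rewrite divr_ge0 ?(ltW (l0 n)) //= ler_pM ?invr_ge0 ?(ltW (l0 n)) //.
  by rewrite lef_pV2 ?posrE // l0.
have opt n : f (P n) = (fr n)%:E /\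
    forall y, ((fr n + c n (P n) - c n y)%:E <= f y)%E.
  apply: argmin_fin_num => //.
  by have [_ _ ? _] := iterates n.+1 isT.
have step n : [/\ fr n.+1 + h (P n.+1)
      + M1 sigma Lh nu mu lamlo lamhi alpha * enorm (X n.+1 - P n.+1) ^+ 2
    <= fr n + h (P n)
      + M2 Lh Lu nu mu lamlo lamhi alpha * enorm (X n - P n) ^+ 2,
    enorm (X n.+1 - P n) <= lamhi * Lh * enorm (X n - P n)
  & enorm (X n.+1 - X n) <= C2 * enorm (X n - P n)].
  apply: (tseng_descent Lh_ge0 h_smooth sigma_gt0 u_sconvex Lu_gt0 u_smooth
    nu_gt0 mu_gt0 lamlo_gt0 (lb n) (lb n.+1) (ab n.+1)).
    by have [] := iterates n.+1 isT.
  (* Optimality of [P n.+1] tested at the previous point [P n]. *)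
  have := (opt n.+1).2 (P n); rewrite (opt n).1 lee_fin lerBlDr.
  exact.
have lhi0 : 0 <= lamhi by lra.
have C20 : 0 <= C2 by rewrite addr_ge0 // mulr_ge0.
have q'0 : 0 <= q' by rewrite divr_ge0 // ltW.
have XX n : enorm (X n.+1 - X n) <= C2 * enorm (X n - P n) by case: (step n).
have XP n : enorm (X n.+1 - P n) <= C2 * enorm (X n - P n).
  case: (step n) => _ + _ => /le_trans; apply.
  by rewrite ler_wpM2r ?enorm_ge0 // lerDr.
have N20 := M2_ge0 Lh_ge0 Lu_gt0 nu_gt0 mu_gt0 lamlo_gt0 alpha_ge0 lamhi_gt.
have [low lowP] := objective_bounded_below f_bounded h_smooth Lh_ge0 fh_coercive.
pose K := lamlo^-1 * (Lu / 2) + Lh / 2.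
have V0 : 0 <= lamlo^-1 by rewrite invr_ge0 ltW.
have LV0 : 0 <= lamlo^-1 * Lu by rewrite mulr_ge0 // ltW.
have K0 : 0 <= K.
  by rewrite addr_ge0 ?divr_ge0 // mulrA divr_ge0.
pose w n := grad h (P n) - grad h (X n)
  + (l n)^-1 *: (grad u (X n) - grad u (P n)) + q n *: (X n - x n).
have fP n : f (P n) = (fr n)%:E by exact: (opt n).1.
have opt_real n y r : f y = r%:E -> fr n + c n (P n) - c n y <= r.
  by move=> fyE; have := (opt n).2 y; rewrite fyE lee_fin.
have prox n y : ((fr n + h (P n) + dotv (w n) (y - P n)
    - K * enorm (y - P n) ^+ 2)%:E <= objective f h y)%E.
  apply: le_trans (tseng_prox_subgradient h_smooth u_smooth (l0 n) (opt n).2 y).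
  rewrite lee_fin lerD2l lerN2 ler_wpM2r ?sqr_ge0 // lerD2r.
  rewrite ler_wpM2r ?divr_ge0 ?(ltW Lu_gt0) //.
  by case/andP: (lb n) => ll _; rewrite lef_pV2 ?posrE.
have wn n : enorm (w n.+1) <= (Lh + lamlo^-1 * Lu + q' * C2)
    * (enorm (X n - P n) + enorm (X n.+1 - P n.+1)).
  case/andP: (lb n.+1) => ll _.
  apply: le_trans (tseng_subgradient_norm (P n.+1) (X n.+1) (x n.+1) h_smooth
    u_smooth Lu_gt0 lamlo_gt0 ll (qb n.+1)) _.
  (* The inertial part of [w n.+1] involves [X n.+1 - X n], which brings in the gap of the previous
     step. *)
  have := ler_wpM2l q'0 (XX n).
  have := mulr_ge0 (addr_ge0 Lh_ge0 LV0) (enorm_ge0 (X n - P n)).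
  have := mulr_ge0 (mulr_ge0 q'0 C20) (enorm_ge0 (X n.+1 - P n.+1)).
  rewrite -/(X n); move: (enorm (X n - P n)) (enorm (X n.+1 - P n.+1)).
  move: (enorm (X n.+1 - X n)) (lamlo^-1 * Lu) => T v A B; lra.
have val (k : nat -> nat) (y : 'rV[R]_m) (lim : R) : (forall j, (j < k j)%N) ->
    enorm (X n - P n) @[n --> \oo] --> 0 ->
    enorm (P (k j) - y) @[j --> \oo] --> 0 ->
    fr (k j) + h (P (k j)) @[j --> \oo] --> lim ->
    objective f h y = lim%:E.
  move=> kj acvg Py grl.
  have Pk : P (k j) @[j --> \oo] --> y by exact/cvg_enorm.
  have hk : h (P (k j)) @[j --> \oo] --> h y.
    exact: cvg_comp Pk (differentiable_continuous (h_smooth.1 y)).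
  have frl : fr (k j) @[j --> \oo] --> lim - h y.
    have -> : (fun j => fr (k j)) =
        (fun j => fr (k j) + h (P (k j)) - h (P (k j))).
      by apply/funext => j; rewrite addrK.
    exact: cvgB grl hk.
  suff fyE : f y = (lim - h y)%:E by rewrite /objective fyE -EFinD subrK.
  (* Lower semicontinuity bounds [f y] by the limit of the values [fr (k j)]; the reverse bound
     needs optimality, through [tseng_opt_gap], as [f] may be discontinuous. *)
  apply/eqP; rewrite eq_le; apply/andP; split.
    exact: (lsc_cvg_le f_lsc Pk (fun j => fP (k j)) frl).
  have kS j : (k j).-1.+1 = k j by rewrite prednK // (leq_trans _ (kj j)).
  have kk : k j @[j --> \oo] --> \oo by apply: cvg_index => j; exact: ltnW.
  have kk1 : (k j).-1 @[j --> \oo] --> \oo.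
    by apply: cvg_index => j; rewrite -ltnS kS.
  have dP : enorm (y - P (k j)) @[j --> \oo] --> 0.
    by under eq_cvg do rewrite enormB.
  have dX : enorm (y - X (k j)) @[j --> \oo] --> 0.
    have d0 : enorm (y - P (k j)) + enorm (X (k j) - P (k j))
        @[j --> \oo] --> 0.
      rewrite -[X in _ --> X](addr0 0); apply: cvgD => //.
      exact: cvg_comp kk acvg.
    apply: (squeeze_cvgr _ (cvg_cst 0) d0); apply: nearW => j.
    rewrite enorm_ge0 (enormB (X _)).
    have -> : y - X (k j) = (y - P (k j)) + (P (k j) - X (k j)).
      by rewrite addrA subrK.
    exact: enormD.
  have dT : enorm (X (k j) - x (k j)) @[j --> \oo] --> 0.
    have d0 : C2 * enorm (X (k j).-1 - P (k j).-1) @[j --> \oo] --> 0.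
      rewrite -[X in _ --> X](mulr0 C2); apply: cvgM; first exact: cvg_cst.
      exact: cvg_comp kk1 acvg.
    apply: (squeeze_cvgr _ (cvg_cst 0) d0); apply: nearW => j.
    by rewrite enorm_ge0 -{1 2}(kS j) XX.
  (* For finite [f y] the error in [tseng_opt_gap] tends to 0 by [dP], [dX] and [dT]; if [f y] is
     infinite the bound is immediate. *)
  case fyE: (f y) => [r| |]; last by have := f_proper.1 y; rewrite fyE.
    rewrite lee_fin; have gap j := tseng_opt_gap h_smooth u_smooth sigma_gt0
      u_sconvex Lu_gt0 lamlo_gt0 (proj1 (andP (lb (k j)))) (qb (k j))
      (opt_real (k j) y r fyE).
    apply: (ler_cvg_to frl _ (nearW _ gap)).
    rewrite [X in _ --> X](_ : _ = r + (lamlo^-1 * (Lu / 2) * (0 * 0)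
      + 0 * (enorm (grad h y) + Lh * 0 + q' * 0))); last by ring.
    apply: cvgD; first exact: cvg_cst.
    apply: cvgD; first by apply: cvgM; [exact: cvg_cst | exact: cvgM].
    apply: cvgM => //; apply: cvgD; last by apply: cvgM => //; exact: cvg_cst.
    by apply: cvgD; [exact: cvg_cst | apply: cvgM => //; exact: cvg_cst].
  exact: leey.
have [[N [C asum]] [xs [crits Xxs Pxs]]] : (exists N C, forall n,
     \sum_(i < n) enorm (X (N + i)%N - P (N + i)%N) <= C) /\
  exists xs, [/\ crit (objective f h) xs, X n @[n --> \oo] --> xs
    & P n @[n --> \oo] --> xs].
  apply: (descent_KL_convergence N20 M_lt K0 _ C20 fh_coercive lowP _ prox _ wn
    XP XX val H_KL).
  - by rewrite !addr_ge0 // mulr_ge0.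
  - by move=> n; rewrite /objective fP.
  - by move=> n; case: (step n).
split; last first.
  by exists xs; split => //; rewrite -cvg_shiftS.
split.
  (* The tail from [N] in the shifted sequences is the tail from [N.+1] in the original ones. *)
  apply: (@nneseries_lt_pinfty _ _ N.+1 1 C) => n; first exact: enorm_ge0.
  exact: asum.
apply: (@nneseries_lt_pinfty _ _ N.+1 0 (C2 * C)) => n; first exact: enorm_ge0.
apply: (le_trans _ (ler_wpM2l C20 (asum n))); rewrite mulr_sumr.
by apply: ler_sum => i _; exact: XX.
Qed.
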